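(* There exist sets $X_0, X_1 \subseteq \mathbb{N}$ whose nonuniform generic degrees form a minimal pair; that is, neither $X_0$ nor $X_1$ is generically computable, and every set $Y \subseteq \mathbb{N}$ that is nonuniformly generically reducible both to $X_0$ and to $X_1$ is generically computable. Consequently, the uniform generic degrees of $X_0$ and $X_1$ also form a minimal pair: neither $X_0$ nor $X_1$ is generically computable, and every set $Y$ that is uniformly generically reducible both to $X_0$ and to $X_1$ is generically computable.
   Context: A set $A \subseteq \mathbb{N}$ has density $1$ if $\lim_n |A \cap \{0,\dots,n-1\}|/n = 1$. A generic description of a set $A$ is a partial function $f$ such that $\mathrm{dom} f$ has density $1$ and $f(n)=A(n)$ whenever $f(n)$ is defined. A set is generically computable if it has a partial computable generic description. An enumeration operator is a c.e. set $W$ of pairs $(F,k)$ with $F$ finite; for $X \subseteq \mathbb{N}$, $W^X = \{k : \exists (F,k)\in W\, [F\subseteq X]\}$. A partial function is identified with its graph (coded as a set of natural numbers), and $W^g$ means $W^{\mathrm{graph}(g)}$; a partial function $h$ is enumeration reducible to $g$ if $\mathrm{graph}(h) = W^g$ for some enumeration operator $W$. $A$ is nonuniformly generically reducible to $B$ if for every generic description $f$ of $B$ there is a generic description of $A$ that is enumeration reducible to $f$. $A$ is uniformly generically reducible to $B$ if there is a single enumeration operator $W$ such that for every generic description $f$ of $B$, $W^f$ is (the graph of) a generic description of $A$. The generic degrees are the equivalence classes under the corresponding reducibility, with least element the degree of the generically computable sets; a minimal pair is a pair of degrees $\mathbf a, \mathbf b > \mathbf 0$ such that any $\mathbf c$ with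 $\mathbf c \le \mathbf a$ and $\mathbf c \le \mathbf b$ equals $\mathbf 0$. *)

(* Defs.v *)
(* Stdlib (vanilla) development. *)
From Stdlib Require Import Reals List Arith Cantor ClassicalEpsilon.
Import ListNotations.

(** * Partial computable functions *)

(* Kleene's mu-recursive functions.  Codes carry no arity: a code applied to
   an argument list of an unsuitable length is undefined, so on arguments of a
   fixed length n exactly the n-ary partial computable functions arise. *)
Inductive recfun : Type :=
| Zero : recfun
| Succ : recfun
| Proj : nat -> recfun
| Comp : recfun -> list recfun -> recfun
| PrimRec : recfun -> recfun -> recfun
| Min : recfun -> recfun.

(* [eval c xs y]: the computation of [c] on [xs] halts with output [y]. *)
Inductive eval : recfun -> list nat -> nat -> Prop :=
| eval_Zero xs :
    eval Zero xs 0
| eval_Succ x :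
    eval Succ [x] (S x)
| eval_Proj i xs x :
    nth_error xs i = Some x -> eval (Proj i) xs x
| eval_Comp f gs xs zs y :
    Forall2 (fun g z => eval g xs z) gs zs -> eval f zs y ->
    eval (Comp f gs) xs y
| eval_PrimRec_O f g xs y :
    eval f xs y -> eval (PrimRec f g) (0 :: xs) y
| eval_PrimRec_S f g n xs z y :
    eval (PrimRec f g) (n :: xs) z -> eval g (n :: z :: xs) y ->
    eval (PrimRec f g) (S n :: xs) y
| eval_Min f xs n :
    eval f (n :: xs) 0 ->
    (forall m, m < n -> exists k, eval f (m :: xs) (S k)) ->
    eval (Min f) xs n.

(* Partial functions on nat are maps into [option nat], [None] meaning
   "undefined"; no computability is implied by the type, as the classical
   axioms are in force. *)
Definition partial_computable (f : nat -> option nat) : Prop :=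
  exists c : recfun, forall n v, f n = Some v <-> eval c [n] v.

(* A set of pairs is c.e. if it is the domain of a binary partial computable
   function. *)
Definition ce_pairs (W : nat -> nat -> Prop) : Prop :=
  exists c : recfun, forall u k, W u k <-> exists y, eval c [u; k] y.

(** * Density and generic descriptions *)

Definition char_bool (A : nat -> Prop) (n : nat) : bool :=
  if excluded_middle_informative (A n) then true else false.

Definition count_below (A : nat -> Prop) (n : nat) : nat :=
  length (filter (char_bool A) (seq 0 n)).

(* The value at n = 0 is irrelevant to the limit. *)
Definition density_one (A : nat -> Prop) : Prop :=
  Un_cv (fun n => INR (count_below A n) / INR n)%R 1%R.

Definition dom (f : nat -> option nat) (n : nat) : Prop :=
  exists v, f n = Some v.

Definition generic_description (A : nat -> Prop) (f : nat -> option nat) : Prop :=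
  density_one (dom f) /\
  forall n v, f n = Some v -> v = Nat.b2n (char_bool A n).

Definition generically_computable (A : nat -> Prop) : Prop :=
  exists f, partial_computable f /\ generic_description A f.

(** * Enumeration operators *)

(* [Cantor.to_nat] is the Cantor pairing bijection. *)
Definition graph (f : nat -> option nat) (x : nat) : Prop :=
  exists n v, f n = Some v /\ x = Cantor.to_nat (n, v).

(* The finite set with canonical index u, i.e. u is the sum of the 2^i for
   i in the set. *)
Definition finite_set (u : nat) (i : nat) : Prop := Nat.testbit u i = true.

(* In an operator [W : nat -> nat -> Prop], [W u k] says that the pair
   (finite_set u, k) belongs to W. *)
Definition apply_operator (W : nat -> nat -> Prop) (X : nat -> Prop) (k : nat)
  : Prop :=
  exists u, W u k /\ forall i, finite_set u i -> X i.

Definition yields (W : nat -> nat -> Prop) (g h : nat -> option nat) : Prop :=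
  forall x, graph h x <-> apply_operator W (graph g) x.

Definition enumeration_reducible (h g : nat -> option nat) : Prop :=
  exists W, ce_pairs W /\ yields W g h.

(** * Generic reducibilities *)

Definition nonuniformly_generically_reducible (A B : nat -> Prop) : Prop :=
  forall f, generic_description B f ->
  exists h, generic_description A h /\ enumeration_reducible h f.

Definition uniformly_generically_reducible (A B : nat -> Prop) : Prop :=
  exists W, ce_pairs W /\
  forall f, generic_description B f ->
  exists h, generic_description A h /\ yields W f h.

(* The degrees of X0 and X1 under the reducibility [red] form a minimal pair;
   for both reducibilities above the least degree consists of the generically
   computable sets. *)
Definition minimal_pair (red : (nat -> Prop) -> (nat -> Prop) -> Prop)
    (X0 X1 : nat -> Prop) : Prop :=
  ~ generically_computable X0 /\
  ~ generically_computable X1 /\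
  forall Y, red Y X0 -> red Y X1 -> generically_computable Y.

(* Main.v *)
Require Import Defs.
From Stdlib Require Import Reals List Arith Cantor ClassicalEpsilon Lia Lra Sorted.
Import ListNotations.

(* A finite injury construction produces sets X0 and X1 of density 0, so that the
   function which is 0 off X_b and undefined on X_b is a generic description of
   X_b.  Requirement (b, c) waits for a large s at which the partial function c
   takes the value 0, puts s into X_b and withdraws all elements of lower
   priority; hence c does not describe X_b.  Withdrawing gives the key property:
   if finite sets u and v avoid the approximations of X0 and X1 at the same
   stage, then u avoids X0 or v avoids X1 in the end.  So if operators W and V
   produce descriptions of Y from the two descriptions above, any value on which
   W and V agree at some stage is correct, although the axioms used may be
   destroyed later; searching for such agreements is a partial computable
   generic description of Y. *)

(** The descriptions that are 0 off [X_b] carry no negative information, so an axiom used at stage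
    [s] is spoiled in one way only: some number at which it demands the value 0 enters [X_b]. The
    danger is that one axiom is spoiled through X0 and later the other through X1 by a different
    requirement. Withdrawal, together with choosing every witness above the stage of the surviving
    top item, rules this out. The lower bound [i * i] on the witnesses of requirement [i] serves
    density: each requirement holds at most one item, so about [sqrt n] elements at most lie below
    [n]. A stage number is itself a guess [<i, s, w, _>]. Its free last component makes every guess
    return at arbitrarily late stages. The search for agreements must run without an oracle, so the
    whole stack has to be a computable function of the stage. As [eval] is merely an inductive
    relation, a decidable notion of computation certificate is built first. *)

Definition pr (x y : nat) : nat := Cantor.to_nat (x, y).
Definition p1 (z : nat) : nat := fst (Cantor.of_nat z).
Definition p2 (z : nat) : nat := snd (Cantor.of_nat z).

Lemma p1_pr x y : p1 (pr x y) = x.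
Proof. unfold p1, pr. now rewrite Cantor.cancel_of_to. Qed.

Lemma p2_pr x y : p2 (pr x y) = y.
Proof. unfold p2, pr. now rewrite Cantor.cancel_of_to. Qed.

Lemma pr_p z : pr (p1 z) (p2 z) = z.
Proof. unfold p1, p2, pr. rewrite <- surjective_pairing. apply Cantor.cancel_to_of. Qed.

Lemma pr_le_l x y : x <= pr x y.
Proof. unfold pr. pose proof (Cantor.to_nat_non_decreasing x y). lia. Qed.

Lemma pr_le_r x y : y <= pr x y.
Proof. unfold pr. pose proof (Cantor.to_nat_non_decreasing x y). lia. Qed.

Lemma pr_inj x y x' y' : pr x y = pr x' y' -> x = x' /\ y = y'.
Proof.
  intros E. split.
  - rewrite <- (p1_pr x y), <- (p1_pr x' y'). now f_equal.
  - rewrite <- (p2_pr x y), <- (p2_pr x' y'). now f_equal.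
Qed.

(** * Total computable functions *)

(** The generated induction principle gives no hypotheses for the evaluations nested inside
    [Forall2] and under the existential of [eval_Min]; the explicit fixpoint supplies them. *)
Lemma eval_ind_nested (P : recfun -> list nat -> nat -> Prop)
  (HZ : forall xs, P Zero xs 0)
  (HS : forall x, P Succ [x] (S x))
  (HP : forall i xs x, nth_error xs i = Some x -> P (Proj i) xs x)
  (HC : forall f gs xs zs y, Forall2 (fun g z => P g xs z) gs zs ->
    P f zs y -> P (Comp f gs) xs y)
  (HO : forall f g xs y, P f xs y -> P (PrimRec f g) (0 :: xs) y)
  (HR : forall f g n xs z y, P (PrimRec f g) (n :: xs) z ->
    P g (n :: z :: xs) y -> P (PrimRec f g) (S n :: xs) y)
  (HM : forall f xs n, P f (n :: xs) 0 ->
    (forall m, m < n -> exists k, P f (m :: xs) (S k)) -> P (Min f) xs n) :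
  forall c xs y, eval c xs y -> P c xs y.
Proof.
  fix IH 4. intros c xs y H.
  destruct H as [xs|x|i xs x H|f gs xs zs y HF H|f g xs y H|f g n xs z y H1 H2|f xs n H1 H2].
  - apply HZ.
  - apply HS.
  - now apply HP.
  - apply HC with (zs := zs); [|now apply IH].
    clear H. induction HF as [|g z gs zs Hg HF IHF]; constructor; [now apply IH|exact IHF].
  - apply HO. now apply IH.
  - apply HR with (z := z); now apply IH.
  - apply HM; [now apply IH|].
    intros m Hm. destruct (H2 m Hm) as [k Hk]. exists k. now apply IH.
Qed.

Lemma eval_functional c xs y y' : eval c xs y -> eval c xs y' -> y = y'.
Proof.
  intros H. revert y'.
  induction H as [xs|x|i xs x H|f gs xs zs y HF IH|f g xs y IH|f g n xs z y IH1 IH2|f xs n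
    IH1 IH2]
    using eval_ind_nested; intros y' H'.
  - now inversion H'.
  - now inversion H'.
  - inversion H'; congruence.
  - inversion H' as [| | |f' gs' xs' zs' y'' HF' Hf| | |]; subst.
    assert (zs = zs') as <-; [|now apply IH].
    clear -HF HF'. revert zs' HF'.
    induction HF; intros zs' HF'; inversion HF'; subst; f_equal; auto.
  - inversion H'; subst. auto.
  - inversion H'; subst. match goal with H : eval (PrimRec _ _) _ _ |- _ => apply IH1 in H end.
    subst. auto.
  - inversion H' as [| | | | | |f' xs' n' H1 H2]; subst.
    (* If two minimisation results differed, the smaller one would be an argument with both value 0
       and a positive value. *)
    destruct (lt_eq_lt_dec n y') as [[Hlt| ->]|Hlt]; [|reflexivity|].
    + destruct (H2 n Hlt) as [k Hk]. apply IH1 in Hk. discriminate.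
    + destruct (IH2 y' Hlt) as [k Hk]. apply Hk in H1. discriminate.
Qed.

Definition computable (f : nat -> nat) : Prop := exists c, forall x, eval c [x] (f x).
Definition computable2 (F : nat -> nat -> nat) : Prop :=
  exists c, forall x y, eval c [x; y] (F x y).
Definition decidable (p : nat -> bool) : Prop := computable (fun e => Nat.b2n (p e)).

Create HintDb computable discriminated.
#[local] Hint Constants Opaque : computable.

Ltac evals :=
  repeat first
    [ eassumption
    | match goal with
      | H : forall x, eval ?c [x] _ |- eval ?c _ _ => apply H
      | H : forall x y, eval ?c [x; y] _ |- eval ?c _ _ => apply H
      end
    | apply eval_Zero | apply eval_Succ | apply eval_Proj; reflexivity
    | eapply eval_Comp | apply Forall2_nil | apply Forall2_cons ].

Lemma computable_id : computable (fun e => e).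
Proof. exists (Proj 0). intros x. evals. Qed.

Lemma computable_S f : computable f -> computable (fun e => S (f e)).
Proof. intros [c Hc]. exists (Comp Succ [c]). intros x. evals. Qed.

Lemma computable_const k : computable (fun _ => k).
Proof.
  induction k as [|k IH]; [|now apply (computable_S (fun _ => k))].
  exists Zero. intros x. evals.
Qed.

Lemma computable2_app F f g : computable2 F -> computable f -> computable g -> computable
  (fun e => F (f e) (g e)).
Proof. intros [c Hc] [a Ha] [b Hb]. exists (Comp c [a; b]). intros x. evals. Qed.

Lemma computable_app f g : computable f -> computable g -> computable (fun e => f (g e)).
Proof. intros [c Hc] [b Hb]. exists (Comp c [b]). intros x. evals. Qed.

Lemma computable2_rec (b : nat -> nat) (s : nat -> nat -> nat) :
  computable b -> computable2 s ->
  computable2 (fun n y => nat_rect (fun _ => nat) (b y) (fun _ r => s r y) n).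
Proof.
  intros [cb Hb] [cs Hs]. exists (PrimRec cb (Comp cs [Proj 1; Proj 2])).
  intros n y. induction n as [|n IH]; simpl.
  - apply eval_PrimRec_O. evals.
  - eapply eval_PrimRec_S; [exact IH|]. evals.
Qed.

Lemma computable2_ext F G : (forall x y, F x y = G x y) -> computable2 F -> computable2 G.
Proof. intros E [c Hc]. exists c. intros x y. rewrite <- E. apply Hc. Qed.

Lemma computable_ext f g : (forall x, f x = g x) -> computable f -> computable g.
Proof. intros E [c Hc]. exists c. intros x. rewrite <- E. apply Hc. Qed.

Lemma computable2_l f : computable f -> computable2 (fun x _ => f x).
Proof. intros [c Hc]. exists (Comp c [Proj 0]). intros x y. evals. Qed.

Lemma computable2_r f : computable f -> computable2 (fun _ y => f y).
Proof. intros [c Hc]. exists (Comp c [Proj 1]). intros x y. evals. Qed.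

Lemma computable2_swap F : computable2 F -> computable2 (fun x y => F y x).
Proof. intros [c Hc]. exists (Comp c [Proj 1; Proj 0]). intros x y. evals. Qed.

Lemma computable2_compose F G H :
  computable2 F -> computable2 G -> computable2 H -> computable2 (fun x y => F (G x y) (H x
    y)).
Proof. intros [c Hc] [a Ha] [b Hb]. exists (Comp c [a; b]). intros x y. evals. Qed.

Lemma computable2_add : computable2 Nat.add.
Proof.
  eapply computable2_ext; [|apply (computable2_rec (fun y => y) (fun r _ => S r))].
  - intros x y. induction x as [|x IH]; simpl in *; congruence.
  - apply computable_id.
  - apply (computable2_l S), computable_S, computable_id.
Qed.

Lemma computable2_mul : computable2 Nat.mul.
Proof.
  eapply computable2_ext; [|apply (computable2_rec (fun _ => 0) (fun r y => y + r))].
  - intros x y. induction x as [|x IH]; simpl in *; congruence.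
  - apply computable_const.
  - apply computable2_swap, computable2_add.
Qed.

Lemma computable_pred : computable pred.
Proof.
  exists (PrimRec Zero (Proj 0)). intros [|x].
  - apply eval_PrimRec_O. evals.
  (* Recursion is strict: [eval_PrimRec_S] demands a value at [x], although [Proj 0] then returns
     the counter. *)
  - assert (exists z, eval (PrimRec Zero (Proj 0)) [x] z) as [z Hz].
    { induction x as [|x [z Hz]].
      - exists 0. apply eval_PrimRec_O. evals.
      - exists x. eapply eval_PrimRec_S; [exact Hz|evals]. }
    eapply eval_PrimRec_S; [exact Hz|evals].
Qed.

Lemma computable2_sub : computable2 Nat.sub.
Proof.
  apply (computable2_swap (fun y x => x - y)).
  eapply computable2_ext; [|apply (computable2_rec (fun y => y) (fun r _ => pred r))].
  - intros x y. induction x as [|x IH]; simpl in *; lia.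
  - apply computable_id.
  - apply computable2_l, computable_pred.
Qed.

(** With truncated subtraction, [1 - C] is 1 exactly when [C] is 0, and [1 - (1 - C)] is its
    complement; these two factors select the branch. *)
Lemma computable2_if (C A B : nat -> nat -> nat) :
  computable2 C -> computable2 A -> computable2 B ->
  computable2 (fun x y => if C x y =? 0 then A x y else B x y).
Proof.
  intros HC HA HB.
  assert (H1 : computable2 (fun _ _ => 1)) by apply (computable2_l _ (computable_const 1)).
  eapply computable2_ext; [|exact (computable2_compose _ _ _ computable2_add
     (computable2_compose _ _ _ computable2_mul (computable2_compose _ _ _ computable2_sub H1
       HC) HA)
     (computable2_compose _ _ _ computable2_mul (computable2_compose _ _ _ computable2_sub H1
        (computable2_compose _ _ _ computable2_sub H1 HC)) HB))].
  intros x y. cbv beta. destruct (C x y) as [|[|k]]; simpl; lia.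
Qed.

(** * Computability of the Cantor pairing and its projections *)

Fixpoint tri (n : nat) : nat := match n with 0 => 0 | S m => S m + tri m end.

Lemma computable_primrec0 (a : nat) (s : nat -> nat -> nat) :
  computable2 s -> computable (nat_rect (fun _ => nat) a (fun n r => s n r)).
Proof.
  intros [cs Hs]. destruct (computable_const a) as [ca Ha].
  (* The code [ca] is known to evaluate on one-element lists, so a dummy parameter 0 is carried
     through the recursion. *)
  exists (Comp (PrimRec ca (Comp cs [Proj 0; Proj 1])) [Proj 0; Zero]).
  intros n. eapply eval_Comp with (zs := [n; 0]); [evals|].
  induction n as [|n IH]; simpl.
  - apply eval_PrimRec_O. evals.
  - eapply eval_PrimRec_S; [exact IH|evals].
Qed.

Lemma computable_tri : computable tri.
Proof.
  eapply computable_ext; [|apply (computable_primrec0 0 (fun n r => S n + r))].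
  - intros x. induction x as [|x IH]; [reflexivity|]. simpl in *. now rewrite IH.
  - apply (computable2_compose Nat.add (fun n _ => S n) (fun _ r => r)).
    + apply computable2_add.
    + apply (computable2_l S), computable_S, computable_id.
    + apply (computable2_r (fun r => r)), computable_id.
Qed.

Lemma pr_tri x y : pr x y = y + tri (x + y).
Proof.
  unfold pr. enough (2 * to_nat (x, y) = 2 * (y + tri (x + y))) by lia.
  pose proof (Cantor.to_nat_spec x y) as E.
  assert (H : forall n, 2 * tri n = n * S n) by (induction n; simpl in *; lia).
  specialize (H (x + y)). nia.
Qed.

Lemma computable2_pr : computable2 pr.
Proof.
  eapply computable2_ext; [intros; symmetry; apply pr_tri|].
  apply (computable2_compose Nat.add (fun _ y => y) (fun x y => tri (x + y))).
  - apply computable2_add.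
  - apply (computable2_r (fun r => r)), computable_id.
  - destruct computable_tri as [c Hc], computable2_add as [d Hd].
    exists (Comp c [d]). intros. evals.
Qed.

(* The index of the diagonal of the Cantor enumeration that contains [z]. *)
Definition diagonal (z : nat) : nat :=
  nat_rect (fun _ => nat) 0
    (fun n r => if tri (S r) - S n =? 0 then S r else r) z.

Lemma computable_diagonal : computable diagonal.
Proof.
  apply computable_primrec0. apply (computable2_if (fun n r => tri (S r) - S n) (fun n r => S
    r) (fun n r => r)).
  - apply (computable2_compose Nat.sub (fun n r => tri (S r)) (fun n r => S n)).
    + apply computable2_sub.
    + apply computable2_r, computable_app; [apply computable_tri|apply computable_S,
      computable_id].
    + apply (computable2_l S), computable_S, computable_id.
  - apply (computable2_r S), computable_S, computable_id.
  - apply (computable2_r (fun r => r)), computable_id.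
Qed.

Lemma diagonal_spec z : tri (diagonal z) <= z < tri (S (diagonal z)).
Proof.
  induction z as [|z IH]; [simpl; lia|].
  change (diagonal (S z)) with
    (if tri (S (diagonal z)) - S z =? 0 then S (diagonal z) else diagonal z).
  destruct (Nat.eqb_spec (tri (S (diagonal z)) - S z) 0); simpl in *; lia.
Qed.

(** The intervals from [tri d] up to [tri (S d)] are disjoint, and [pr_tri] puts [z] into the one
    with index [p1 z + p2 z]; hence [diagonal z] recovers this sum. *)
Lemma p_diagonal z : p2 z = z - tri (diagonal z) /\ p1 z = diagonal z - p2 z.
Proof.
  pose proof (diagonal_spec z) as H. pose proof (pr_p z) as E. rewrite pr_tri in E.
  assert (Hm : forall a b, a <= b -> tri a <= tri b) by (induction 1; simpl; lia).
  assert (D : diagonal z = p1 z + p2 z).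
  { destruct (lt_eq_lt_dec (diagonal z) (p1 z + p2 z)) as [[L|L]|L]; [|exact L|].
    - pose proof (Hm _ _ L). lia.
    - pose proof (Hm _ _ L). simpl in *. lia. }
  rewrite D. lia.
Qed.

Lemma computable_p2 f : computable f -> computable (fun e => p2 (f e)).
Proof.
  apply computable_app. eapply computable_ext; [intros; symmetry; apply p_diagonal|].
  apply (computable2_app Nat.sub); [apply computable2_sub|apply computable_id|].
  apply computable_app; [apply computable_tri|apply computable_diagonal].
Qed.

Lemma computable_p1 f : computable f -> computable (fun e => p1 (f e)).
Proof.
  apply computable_app. eapply computable_ext; [intros; symmetry; apply p_diagonal|].
  apply (computable2_app Nat.sub); [apply computable2_sub|apply computable_diagonal|].
  apply computable_p2, computable_id.
Qed.

Lemma computable_pr f g : computable f -> computable g -> computable (fun e => pr (f e) (g e)).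
Proof. apply computable2_app, computable2_pr. Qed.

Lemma computable_add f g : computable f -> computable g -> computable (fun e => f e + g e).
Proof. apply computable2_app, computable2_add. Qed.

Lemma computable_mul f g : computable f -> computable g -> computable (fun e => f e * g e).
Proof. apply computable2_app, computable2_mul. Qed.

Lemma computable_sub f g : computable f -> computable g -> computable (fun e => f e - g e).
Proof. apply computable2_app, computable2_sub. Qed.

Lemma computable_pred_app f : computable f -> computable (fun e => pred (f e)).
Proof. apply computable_app, computable_pred. Qed.

(* Here and below the variables in scope are packed into one number, so that a
   function under binders is computable as a function of the packed variables. *)
Lemma computable_rec f b (g : nat -> nat -> nat -> nat) :
  computable f -> computable b -> computable (fun z => g (p1 (p1 z)) (p2 (p1 z)) (p2 z)) ->
  computable (fun e => nat_rect (fun _ => nat) (f e) (fun n r => g n r e) (b e)).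
Proof.
  intros [cf Hf] [cb Hb] [cg Hg]. destruct computable2_pr as [cp Hp].
  exists (Comp (PrimRec cf (Comp cg [Comp cp [Comp cp [Proj 0; Proj 1]; Proj 2]])) [cb; Proj
    0]).
  intros e. eapply eval_Comp with (zs := [b e; e]); [evals|].
  generalize (b e) as n. induction n as [|n IH]; simpl.
  - apply eval_PrimRec_O. evals.
  - eapply eval_PrimRec_S; [exact IH|].
    pose proof (Hg (pr (pr n (nat_rect (fun _ => nat) (f e) (fun n r => g n r e) n)) e)) as H.
    rewrite !p1_pr, !p2_pr in H. evals.
Qed.

#[local] Hint Resolve computable_id computable_S computable_const computable_p1 computable_p2
  computable_pr computable_add computable_mul
  computable_sub computable_pred_app computable_rec : computable.

(** * Decidable predicates and bounded quantifiers *)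

Lemma decidable_leb f g : computable f -> computable g -> decidable (fun e => f e <=? g e).
Proof.
  intros. apply (computable_ext (fun e => 1 - (f e - g e))); [|auto 20 with computable].
  intros e. destruct (Nat.leb_spec (f e) (g e)); cbn [Nat.b2n]; lia.
Qed.

Lemma decidable_ltb f g : computable f -> computable g -> decidable (fun e => f e <? g e).
Proof. intros. apply (decidable_leb (fun e => S (f e))); auto with computable. Qed.

Lemma decidable_eqb f g : computable f -> computable g -> decidable (fun e => f e =? g e).
Proof.
  intros. apply (computable_ext (fun e => 1 - ((f e - g e) + (g e - f e)))); [|auto 20 with
    computable].
  intros e. destruct (Nat.eqb_spec (f e) (g e)); cbn [Nat.b2n]; lia.
Qed.

Lemma decidable_negb p : decidable p -> decidable (fun e => negb (p e)).
Proof.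
  intros. apply (computable_ext (fun e => 1 - Nat.b2n (p e))); [|unfold decidable in *; auto
    20 with computable].
  intros e. now destruct (p e).
Qed.

Lemma decidable_andb p q : decidable p -> decidable q -> decidable (fun e => p e && q e)%bool.
Proof.
  intros. apply (computable_ext (fun e => Nat.b2n (p e) * Nat.b2n (q e))); [|unfold decidable
    in *; auto 20 with computable].
  intros e. now destruct (p e), (q e).
Qed.

Lemma decidable_orb p q : decidable p -> decidable q -> decidable (fun e => p e || q e)%bool.
Proof.
  intros Hp Hq. apply (computable_ext (fun e => Nat.b2n (negb (negb (p e) && negb (q e))))).
  - intros e. now destruct (p e), (q e).
  - now apply decidable_negb, decidable_andb; apply decidable_negb.
Qed.

Lemma computable_if p f g : decidable p -> computable f -> computable g -> computable (fun
  e => if p e then f e else g e).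
Proof.
  intros. apply (computable_ext (fun e => Nat.b2n (p e) * f e + (1 - Nat.b2n (p e)) * g e));
    [|unfold decidable in *; auto 20 with computable].
  intros e. destruct (p e); cbn [Nat.b2n]; lia.
Qed.

Lemma decidable_forallb (p : nat -> nat -> bool) b :
  computable b -> decidable (fun z => p (p1 z) (p2 z)) ->
  decidable (fun e => forallb (fun i => p i e) (seq 0 (b e))).
Proof.
  intros Hb Hp.
  apply (computable_ext (fun e =>
    nat_rect (fun _ => nat) 1 (fun n r => r * Nat.b2n (p n e)) (b e))).
  - intros e. induction (b e) as [|n IH]; [reflexivity|].
    rewrite seq_S, forallb_app. simpl in *. rewrite IH.
    now destruct (forallb _ _), (p n e).
  - apply computable_rec; auto with computable.
    apply computable_mul; auto with computable.
    eapply computable_ext; [|apply (computable_app _ (fun z => pr (p1 (p1 z)) (p2 z)) Hp)].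
    + intros z. simpl. now rewrite p1_pr, p2_pr.
    + auto with computable.
Qed.

Lemma decidable_existsb (p : nat -> nat -> bool) b :
  computable b -> decidable (fun z => p (p1 z) (p2 z)) ->
  decidable (fun e => existsb (fun i => p i e) (seq 0 (b e))).
Proof.
  intros Hb Hp.
  apply (computable_ext (fun e => Nat.b2n (negb (forallb (fun i => negb (p i e)) (seq 0 (b
    e)))))).
  - intros e. f_equal. induction (seq 0 (b e)) as [|i l IH]; simpl; [reflexivity|].
    rewrite <- IH. now destruct (p i e).
  - apply decidable_negb, (decidable_forallb (fun i e => negb (p i e))); [exact Hb|].
    now apply decidable_negb.
Qed.

#[local] Hint Resolve decidable_leb decidable_ltb decidable_eqb decidable_negb decidable_andb
  decidable_orb computable_if
  decidable_forallb decidable_existsb : computable.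

(** * A universal relation *)

(** The successor reserves 0 for the empty list. Every number then codes exactly one list, and no
    test for well-formed codes is ever required. *)
Definition cons_code (a l : nat) : nat := S (pr a l).
Definition head (z : nat) : nat := p1 (pred z).
Definition tail (z : nat) : nat := p2 (pred z).
Definition drop (i z : nat) : nat := nat_rect (fun _ => nat) z (fun _ r => tail r) i.
Fixpoint code (l : list nat) : nat :=
  match l with [] => 0 | a :: l => cons_code a (code l) end.

Lemma head_cons a l : head (cons_code a l) = a.
Proof. apply p1_pr. Qed.

Lemma tail_cons a l : tail (cons_code a l) = l.
Proof. apply p2_pr. Qed.

Lemma code_surj z : exists l, z = code l.
Proof.
  induction z as [[|z] IH] using (well_founded_induction lt_wf); [now exists []|].
  destruct (IH (p2 z)) as [l Hl].
  - rewrite <- (pr_p z) at 2. pose proof (pr_le_r (p1 z) (p2 z)). lia.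
  - exists (p1 z :: l). simpl. rewrite <- Hl. unfold cons_code. now rewrite pr_p.
Qed.

Lemma code_inj l l' : code l = code l' -> l = l'.
Proof.
  revert l'. induction l as [|a l IH]; intros [|b l'] E; try discriminate; [reflexivity|].
  injection E as E. apply pr_inj in E as [-> E]. f_equal. auto.
Qed.

Lemma drop_S i z : drop (S i) z = tail (drop i z).
Proof. reflexivity. Qed.

Lemma drop_code i l : drop i (code l) = code (skipn i l).
Proof.
  revert l. induction i as [|i IH]; intros l; [now destruct l|].
  rewrite drop_S, IH. clear IH. revert i. induction l as [|a l IH]; intros [|i]; simpl; auto.
  now rewrite tail_cons.
Qed.

(** This allows the code of a list to bound searches through its positions. *)
Lemma length_code l : length l <= code l.
Proof.
  induction l as [|a l IH]; simpl; [lia|].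
  unfold cons_code. pose proof (pr_le_r a (code l)). lia.
Qed.

Lemma computable_cons_code f g : computable f -> computable g -> computable (fun e =>
  cons_code (f e) (g e)).
Proof. intros. unfold cons_code. auto with computable. Qed.

Lemma computable_head f : computable f -> computable (fun e => head (f e)).
Proof. intros. unfold head. auto with computable. Qed.

Lemma computable_tail f : computable f -> computable (fun e => tail (f e)).
Proof. intros. unfold tail. auto with computable. Qed.

#[local] Hint Resolve computable_cons_code computable_head computable_tail : computable.

Lemma computable_drop f g : computable f -> computable g -> computable (fun e => drop (f e)
  (g e)).
Proof. intros. unfold drop. apply computable_rec; auto with computable. Qed.

#[local] Hint Resolve computable_drop : computable.

Definition member (p : nat -> bool) (z : nat) : bool :=
  existsb (fun i => negb (drop i z =? 0) && p (head (drop i z)))%bool (seq 0 z).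

Lemma member_code p l : member p (code l) = true <-> exists x, In x l /\ p x = true.
Proof.
  unfold member. rewrite existsb_exists. split.
  - intros (i & _ & H). apply andb_prop in H as [H1 H2].
    rewrite drop_code in H1, H2.
    pose proof (firstn_skipn i l) as E.
    destruct (skipn i l) as [|x l']; [discriminate|].
    simpl in H2. rewrite head_cons in H2.
    exists x. split; [|exact H2]. rewrite <- E. apply in_or_app. now right; left.
  - intros (x & Hx & Hp). apply in_split in Hx as (l1 & l2 & ->).
    exists (length l1). split.
    + apply in_seq. pose proof (length_code (l1 ++ x :: l2)) as H.
      rewrite length_app in H. simpl in H. lia.
    + rewrite drop_code, skipn_app, skipn_all, Nat.sub_diag. simpl.
      now rewrite head_cons, Hp.
Qed.

Lemma decidable_member (p : nat -> nat -> bool) f :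
  computable f -> decidable (fun z => p (p1 z) (p2 z)) -> decidable (fun e => member (fun
    x => p x e) (f e)).
Proof.
  intros Hf Hp. unfold member. apply (decidable_existsb (fun i e => (negb (drop i (f e) =?
    0) &&
    p (head (drop i (f e))) e)%bool)); [exact Hf|].
  assert (Hf2 : computable (fun z => f (p2 z))) by (apply computable_app; auto with
    computable).
  apply decidable_andb; [auto 10 with computable|].
  eapply computable_ext; [|apply (computable_app _ (fun z => pr (head (drop (p1 z) (f (p2
    z)))) (p2 z)) Hp)].
  - intros z. cbv beta. now rewrite p1_pr, p2_pr.
  - auto 10 with computable.
Qed.

(** * Evaluations as coded derivations *)

Fixpoint recfun_code (c : recfun) : nat :=
  match c with
  | Zero => pr 0 0
  | Succ => pr 1 0
  | Proj i => pr 2 i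
  | Comp f gs => pr 3 (pr (recfun_code f) (code (map recfun_code gs)))
  | PrimRec f g => pr 4 (pr (recfun_code f) (recfun_code g))
  | Min f => pr 5 (recfun_code f)
  end.

(* Judgements [judge tag c xs y] on codes: tag 1 is [eval c xs y], tag 2 is
   [eval] componentwise on a list [c] of functions and a list [y] of values,
   tag 3 says that [c] takes positive values at [m :: xs] for all [m < y].
   Tag 0 is the trivial judgement, so that [0] can serve as a dummy premise. *)
Definition judge (tag c xs y : nat) : nat := pr tag (pr c (pr xs y)).
Definition jtag (j : nat) : nat := p1 j.
Definition jfun (j : nat) : nat := p1 (p2 j).
Definition jargs (j : nat) : nat := p1 (p2 (p2 j)).
Definition jval (j : nat) : nat := p2 (p2 (p2 j)).

Lemma jtag_judge t c xs y : jtag (judge t c xs y) = t.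
Proof. apply p1_pr. Qed.
Lemma jfun_judge t c xs y : jfun (judge t c xs y) = c.
Proof. unfold jfun, judge. now rewrite p2_pr, p1_pr. Qed.
Lemma jargs_judge t c xs y : jargs (judge t c xs y) = xs.
Proof. unfold jargs, judge. now rewrite !p2_pr, p1_pr. Qed.
Lemma jval_judge t c xs y : jval (judge t c xs y) = y.
Proof. unfold jval, judge. now rewrite !p2_pr. Qed.

Lemma computable_judge f g h k : computable f -> computable g -> computable h -> computable
  k ->
  computable (fun e => judge (f e) (g e) (h e) (k e)).
Proof. intros. unfold judge. auto with computable. Qed.
Lemma computable_jtag f : computable f -> computable (fun e => jtag (f e)).
Proof. intros. unfold jtag. auto with computable. Qed.
Lemma computable_jfun f : computable f -> computable (fun e => jfun (f e)).
Proof. intros. unfold jfun. auto with computable. Qed.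
Lemma computable_jargs f : computable f -> computable (fun e => jargs (f e)).
Proof. intros. unfold jargs. auto with computable. Qed.
Lemma computable_jval f : computable f -> computable (fun e => jval (f e)).
Proof. intros. unfold jval. auto with computable. Qed.

#[local] Hint Resolve computable_judge computable_jtag computable_jfun computable_jargs
  computable_jval : computable.

(* [rule j p q]: the judgement [j] follows from the premises [p] and [q]. *)
Definition rule_eval (j p q : nat) : bool :=
  let c := jfun j in let xs := jargs j in let y := jval j in
  let k := p1 c in let a := p1 (p2 c) in let b := p2 (p2 c) in
  (k =? 0) && (y =? 0)
  || (k =? 1) && (xs =? cons_code (head xs) 0) && (y =? S (head xs))
  || (k =? 2) && negb (drop (p2 c) xs =? 0) && (y =? head (drop (p2 c) xs))
  || (k =? 3) && (p =? judge 2 b xs (jval p)) && (q =? judge 1 a (jval p) y)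
  || (k =? 4) && negb (xs =? 0) && (head xs =? 0) && (p =? judge 1 a (tail xs) y)
  || (k =? 4) && negb (xs =? 0) && negb (head xs =? 0)
     && (p =? judge 1 c (cons_code (pred (head xs)) (tail xs)) (jval p))
     && (q =? judge 1 b (cons_code (pred (head xs)) (cons_code (jval p) (tail xs))) y)
  || (k =? 5) && (p =? judge 3 (p2 c) xs y) && (q =? judge 1 (p2 c) (cons_code y xs) 0).

Definition rule_map (j p q : nat) : bool :=
  let c := jfun j in let xs := jargs j in let y := jval j in
  (c =? 0) && (y =? 0)
  || negb (c =? 0) && negb (y =? 0) && (p =? judge 1 (head c) xs (head y))
     && (q =? judge 2 (tail c) xs (tail y)).

Definition rule_search (j p q : nat) : bool :=
  let c := jfun j in let xs := jargs j in let y := jval j in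
  (y =? 0)
  || (p =? judge 3 c xs (pred y)) && (q =? judge 1 c (cons_code (pred y) xs) (jval q))
     && negb (jval q =? 0).

Definition rule (j p q : nat) : bool :=
  (jtag j =? 0) || (jtag j =? 1) && rule_eval j p q || (jtag j =? 2) && rule_map j p q
  || (jtag j =? 3) && rule_search j p q.

Lemma decidable_rule f g h : computable f -> computable g -> computable h -> decidable (fun
  e => rule (f e) (g e) (h e)).
Proof.
  intros. unfold rule, rule_eval, rule_map, rule_search. cbv zeta.
  repeat first [apply decidable_orb | apply decidable_andb | apply decidable_negb | apply
    decidable_eqb]; auto 30 with computable.
Qed.

(** Premises must occur later in the list than their conclusion. The range of [b] and [c] includes
    positions past the end, where [head] returns 0, the dummy premise. *)
Definition derivation (w : nat) : bool :=
  forallb (fun i => (drop i w =? 0)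
     || existsb (fun b => existsb (fun c =>
          rule (head (drop i w)) (head (drop b (drop (S i) w))) (head (drop c (drop (S i) w))))
        (seq 0 (S w))) (seq 0 (S w)))%bool (seq 0 w).

Lemma decidable_derivation f : computable f -> decidable (fun e => derivation (f e)).
Proof.
  intros Hf. apply (computable_app (fun w => Nat.b2n (derivation w))); [|exact Hf].
  unfold derivation.
  apply (decidable_forallb (fun i w => ((drop i w =? 0)
     || existsb (fun b => existsb (fun c =>
          rule (head (drop i w)) (head (drop b (drop (S i) w))) (head (drop c (drop (S i) w))))
        (seq 0 (S w))) (seq 0 (S w)))%bool)); [auto with computable|].
  apply decidable_orb; [auto with computable|].
  apply (decidable_existsb (fun b z => existsb (fun c =>
    rule (head (drop (p1 z) (p2 z))) (head (drop b (drop (S (p1 z)) (p2 z))))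
      (head (drop c (drop (S (p1 z)) (p2 z))))) (seq 0 (S (p2 z))))); [auto with computable|].
  apply (decidable_existsb (fun c z => rule (head (drop (p1 (p2 z)) (p2 (p2 z))))
      (head (drop (p1 z) (drop (S (p1 (p2 z))) (p2 (p2 z)))))
      (head (drop c (drop (S (p1 (p2 z))) (p2 (p2 z)))))));
    [auto with computable|].
  apply decidable_rule; auto 20 with computable.
Qed.

Inductive derivable : list nat -> Prop :=
| derivable_nil : derivable []
| derivable_cons j p q l :
    derivable l -> p = 0 \/ In p l -> q = 0 \/ In q l -> rule j p q = true ->
    derivable (j :: l).

Lemma head_drop_code i l : head (drop i (code l)) = nth i l 0.
Proof.
  rewrite drop_code. revert i. induction l as [|a l IH]; intros [|i]; simpl; auto;
    apply head_cons || reflexivity.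
Qed.

Lemma derivation_code l : derivation (code l) = true <-> derivable l.
Proof.
  unfold derivation. rewrite forallb_forall. split.
  - intros H.
    (* Induction on the length of the suffix, since the premises of an entry lie behind it. *)
    assert (K : forall i, derivable (skipn (length l - i) l)).
    { induction i as [|i IH].
      - rewrite Nat.sub_0_r, skipn_all. constructor.
      - destruct (le_lt_dec (length l) i) as [Hi|Hi].
        { now replace (length l - S i) with (length l - i) by lia. }
        remember (length l - S i) as k eqn:Ek. replace (length l - i) with (S k) in IH by lia.
        assert (Hk : In k (seq 0 (code l))).
        { apply in_seq. pose proof (length_code l). lia. }
        specialize (H k Hk). rewrite !drop_code in H.
        assert (E : skipn k l = nth k l 0 :: skipn (S k) l).
        { assert (Hk' : k < length l) by lia. clear -Hk'. revert k Hk'.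
          induction l as [|a l IH]; intros [|k] Hk; simpl in *; try lia; [reflexivity|].
          rewrite IH by lia. reflexivity. }
        rewrite E in H. rewrite E. apply Bool.orb_prop in H as [H|H]; [discriminate|].
        apply existsb_exists in H as (b & _ & H). apply existsb_exists in H as (c & _ & H).
        rewrite !head_drop_code in H. simpl code in H. rewrite head_cons in H.
        refine (derivable_cons _ _ _ _ IH _ _ H).
        + destruct (nth_in_or_default b (skipn (S k) l) 0); auto.
        + destruct (nth_in_or_default c (skipn (S k) l) 0); auto. }
    specialize (K (length l)). now rewrite Nat.sub_diag in K.
  - intros H i _. rewrite !drop_code.
    assert (G : skipn i l = [] \/ exists p q, (p = 0 \/ In p (skipn (S i) l)) /\
      (q = 0 \/ In q (skipn (S i) l)) /\ rule (head (code (skipn i l))) p q = true).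
    { revert i. induction H as [|j p q l H IH Hp Hq Hr]; intros [|i]; auto.
      - right. exists p, q. simpl. now rewrite head_cons.
      - apply IH. }
    assert (N : forall p, p = 0 \/ In p (skipn (S i) l) ->
      exists b, In b (seq 0 (S (code l))) /\ p = nth b (skipn (S i) l) 0).
    { intros p [->|Hp].
      (* This position is past the end of the tail, so [nth] yields the default 0, which is the
         dummy premise. *)
      - exists (length l). split.
        + apply in_seq. pose proof (length_code l). lia.
        + rewrite nth_overflow; [reflexivity|]. rewrite length_skipn. lia.
      - apply In_nth with (d := 0) in Hp as (b & Hb & E). exists b. split; [|now symmetry].
        rewrite length_skipn in Hb. apply in_seq. pose proof (length_code l). lia. }
    destruct G as [->|(p & q & Hp & Hq & Hr)]; [reflexivity|].
    apply N in Hp as (b & Hb & ->). apply N in Hq as (c & Hc & ->).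
    apply Bool.orb_true_intro. right.
    apply existsb_exists. exists b. split; [exact Hb|].
    apply existsb_exists. exists c. split; [exact Hc|].
    now rewrite !head_drop_code.
Qed.

(** Truth of a judgement, phrased through equations for [j]: a number that is not a judgement about
    genuine codes, in particular the dummy 0, is valid vacuously. *)
Definition valid (j : nat) : Prop :=
  (forall f xs y, j = judge 1 (recfun_code f) (code xs) y -> eval f xs y) /\
  (forall gs xs zs, j = judge 2 (code (map recfun_code gs)) (code xs) (code zs) ->
     Forall2 (fun g z => eval g xs z) gs zs) /\
  (forall f xs n, j = judge 3 (recfun_code f) (code xs) n ->
     forall m, m < n -> exists k, eval f (m :: xs) (S k)).

Ltac split_bools :=
  repeat match goal with
  | H : (_ && _)%bool = true |- _ => apply andb_prop in H; destruct H
  | H : (_ || _)%bool = true |- _ => apply Bool.orb_prop in H; destruct H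
  | H : (_ =? _) = true |- _ => apply Nat.eqb_eq in H
  | H : negb (_ =? _) = true |- _ => apply Bool.negb_true_iff, Nat.eqb_neq in H
  end.

Lemma rule_sound j p q : rule j p q = true -> valid p -> valid q -> valid j.
Proof.
  intros H (P1 & P2 & P3) (Q1 & Q2 & Q3). unfold rule in H.
  split; [|split].
  - intros f xs y ->. rewrite jtag_judge in H. cbn [Nat.eqb andb orb] in H.
    unfold rule_eval in H. rewrite jfun_judge, jargs_judge, jval_judge in H. cbv zeta in H.
    rewrite !Bool.orb_false_r in H.
    destruct f as [| |i|f gs|f g|f]; cbn [recfun_code] in H;
      repeat first [rewrite p1_pr in H | rewrite p2_pr in H]; cbn [Nat.eqb andb orb] in H;
        split_bools; subst;
      try discriminate.
    + constructor.
    + destruct xs as [|x xs]; [discriminate|].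
      change (code (x :: xs)) with (cons_code x (code xs)) in *. rewrite head_cons in *.
      match goal with H : cons_code _ _ = cons_code _ _ |- _ => injection H as H; apply
        pr_inj in H as [_ H] end.
      destruct xs; [|discriminate]. constructor.
    + rewrite drop_code in *. constructor.
      clear -H. revert i H. induction xs as [|x xs IH]; intros [|i] H; simpl in *; try
        congruence.
      * now rewrite head_cons.
      * now apply IH.
    (* Since every number codes a list, the intermediate values claimed by the first premise can be
       decoded. *)
    + destruct (code_surj (jval p)) as [zs Ez]. rewrite Ez in *.
      apply eval_Comp with (zs := zs); [now apply P2|now apply Q1].
    + destruct xs as [|x xs]; simpl in *; [congruence|]. rewrite head_cons, tail_cons in *.
      subst.
      constructor. now apply P1.
    + destruct xs as [|[|x] xs]; simpl in *; [congruence| |]; rewrite head_cons, tail_cons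
      in *; [congruence|].
      simpl in *. econstructor; [apply (P1 (PrimRec f g)); eassumption|].
      now apply Q1.
    + constructor; [now apply Q1|]. intros m Hm. eapply P3; eauto.
  - intros gs xs zs ->. rewrite jtag_judge in H. cbn [Nat.eqb andb orb] in H.
    unfold rule_map in H. rewrite jfun_judge, jargs_judge, jval_judge in H. cbv zeta in H.
    rewrite !Bool.orb_false_r in H.
    destruct gs as [|g gs], zs as [|z zs]; simpl in *; split_bools; try congruence; try
      discriminate.
    + constructor.
    + repeat rewrite head_cons in *; repeat rewrite tail_cons in *. constructor; [now apply
      P1|now apply Q2].
  - intros f xs n ->. rewrite jtag_judge in H. cbn [Nat.eqb andb orb] in H.
    unfold rule_search in H. rewrite jfun_judge, jargs_judge, jval_judge in H. cbv zeta in H.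
    intros m Hm. split_bools; [lia|]. destruct n as [|n]; [lia|]. simpl in *.
    assert (m < n \/ m = n) as [L| ->] by lia; [eapply P3; eauto|].
    destruct (jval q) as [|k]; [congruence|]. exists k. now apply Q1.
Qed.

Lemma valid_0 : valid 0.
Proof.
  assert (E : forall t c xs y, 0 = judge (S t) c xs y -> False).
  { intros t c xs y E. pose proof (pr_le_l (S t) (pr c (pr xs y))). unfold judge in E. lia. }
  repeat split; intros; exfalso; eauto.
Qed.

Lemma derivable_sound l : derivable l -> forall j, In j l -> valid j.
Proof.
  induction 1 as [|j p q l H IH Hp Hq Hr]; intros j' []; subst; auto.
  apply (rule_sound _ _ _ Hr); [destruct Hp as [->|]|destruct Hq as [->|]]; auto using valid_0.
Qed.

Lemma derivable_app l l' : derivable l -> derivable l' -> derivable (l ++ l').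
Proof.
  intros H H'. induction H as [|j p q l H IH Hp Hq Hr]; [exact H'|].
  simpl. econstructor; [exact IH| | |exact Hr]; rewrite in_app_iff; tauto.
Qed.

Definition proves (j : nat) : Prop := exists l, derivable (j :: l).

Lemma proves_rule2 j p q : proves p -> proves q -> rule j p q = true -> proves j.
Proof.
  intros [l Hl] [l' Hl'] H. exists ((p :: l) ++ (q :: l')).
  apply derivable_cons with p q; [now apply derivable_app| | |exact H];
    right; apply in_or_app; simpl; auto.
Qed.

Lemma proves_rule0 j : rule j 0 0 = true -> proves j.
Proof. intros H. exists []. apply derivable_cons with 0 0; auto. constructor. Qed.

Lemma proves_0 : proves 0.
Proof.
  apply proves_rule0. unfold rule, jtag.
  replace (p1 0) with 0; [reflexivity|].
  pose proof (pr_le_l (p1 0) (p2 0)) as H. rewrite pr_p in H. lia.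
Qed.

Ltac rule_simpl :=
  unfold rule, rule_eval, rule_map, rule_search; cbv zeta;
  rewrite ?jtag_judge, ?jfun_judge, ?jargs_judge, ?jval_judge;
  cbn [recfun_code code map]; repeat first [rewrite p1_pr | rewrite p2_pr];
    rewrite ?head_cons, ?tail_cons;
  cbn [pred]; rewrite ?Nat.eqb_refl; cbn [Nat.eqb andb orb negb cons_code];
  rewrite ?Nat.eqb_refl, ?Bool.orb_true_r; try reflexivity.

Lemma eval_proves c xs y : eval c xs y -> proves (judge 1 (recfun_code c) (code xs) y).
Proof.
  induction 1 as [xs|x|i xs x H|f gs xs zs y HF IH|f g xs y IH|f g n xs z y IH1 IH2|f xs n
    IH1 IH2]
    using eval_ind_nested.
  - apply proves_rule0. rule_simpl.
  - apply proves_rule0. rule_simpl.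
  - apply proves_rule0. rule_simpl.
    assert (E : exists l, skipn i xs = x :: l).
    { revert i H. induction xs as [|a xs IH]; intros [|i] H; try discriminate; simpl in *.
      - injection H as ->. eauto.
      - auto. }
    destruct E as [l E]. rewrite drop_code, E. simpl. rewrite head_cons, Nat.eqb_refl.
    reflexivity.
  - apply proves_rule2 with (judge 2 (code (map recfun_code gs)) (code xs) (code zs))
      (judge 1 (recfun_code f) (code zs) y); [|exact IH|rule_simpl].
    clear IH. induction HF as [|g z gs zs Hg HF IHF].
    + apply proves_rule0. rule_simpl.
    + eapply proves_rule2; [exact Hg|exact IHF|]. rule_simpl.
  - eapply proves_rule2; [exact IH|apply proves_0|]. rule_simpl.
  - eapply proves_rule2; [exact IH1|exact IH2|]. rule_simpl.
  - apply proves_rule2 with (judge 3 (recfun_code f) (code xs) n)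
      (judge 1 (recfun_code f) (code (n :: xs)) 0); [|exact IH1|rule_simpl].
    clear IH1. induction n as [|n IHn].
    + apply proves_rule0. rule_simpl.
    + destruct (IH2 n) as [k Hk]; [lia|].
      eapply proves_rule2; [apply IHn; intros; apply IH2; lia|exact Hk|]. rule_simpl.
Qed.

(** A form of Kleene's T predicate: [w] is a decidable certificate for the evaluation, namely a
    derivation with that judgement as its first entry. *)
Definition computation (c xs y w : nat) : bool :=
  (derivation w && negb (w =? 0) && (head w =? judge 1 c xs y))%bool.

Lemma computation_spec c xs y :
  eval c xs y <-> exists w, computation (recfun_code c) (code xs) y w = true.
Proof.
  unfold computation. split.
  - intros H. apply eval_proves in H as [l H]. eexists (code (_ :: l)).
    rewrite (proj2 (derivation_code _) H). simpl. now rewrite head_cons, Nat.eqb_refl.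
  - intros [w H]. split_bools. destruct (code_surj w) as [[|j l] ->]; [simpl in *;
    congruence|].
    apply derivation_code in H. simpl in *. rewrite head_cons in *. subst j.
    now apply (derivable_sound _ H _ (or_introl eq_refl)).
Qed.

Lemma decidable_computation f g h k : computable f -> computable g -> computable h ->
  computable k ->
  decidable (fun e => computation (f e) (g e) (h e) (k e)).
Proof.
  intros. unfold computation. apply decidable_andb; [apply decidable_andb; [now apply
    decidable_derivation|]|];
   auto 10 with computable.
Qed.

#[local] Hint Resolve decidable_derivation decidable_computation : computable.

Lemma partial_computable_search (R : nat -> nat -> bool) (g : nat -> nat) (h : nat -> option
  nat) :
  decidable (fun z => R (p1 z) (p2 z)) -> computable g ->
  (forall n v, h n = Some v <->
     exists t, R n t = true /\ (forall t', t' < t -> R n t' = false) /\ v = g t) ->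
  partial_computable h.
Proof.
  intros HR [cg Hg] Hh. apply decidable_negb in HR as [cR HR]. destruct computable2_pr as [cp
    Hp].
  (* [Min] puts the search variable first and looks for the value 0, hence the exchanged projections
     and the negation. *)
  assert (ER : forall n t, eval (Comp cR [Comp cp [Proj 1; Proj 0]]) [t; n] (Nat.b2n (negb (R
    n t)))).
  { intros n t. pose proof (HR (pr n t)) as H. cbv beta in H. rewrite p1_pr, p2_pr in H.
    evals. }
  set (c := Comp cR [Comp cp [Proj 1; Proj 0]]) in *.
  exists (Comp cg [Min c]). intros n v. rewrite Hh. split.
  - intros (t & H1 & H2 & ->). econstructor; [|apply Hg].
    constructor; [|constructor]. constructor.
    + pose proof (ER n t) as E. now rewrite H1 in E.
    + intros m Hm. exists 0. pose proof (ER n m) as E. now rewrite (H2 m Hm) in E.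
  - intros H. inversion H as [| | |f' gs' xs' zs' y' HF He| | |]; subst.
    inversion HF as [|? t ? ? Ht Hn]; subst. inversion Hn; subst.
    inversion Ht as [| | | | | |f' xs' n' H1 H2]; subst.
    exists t. split; [|split].
    + pose proof (eval_functional _ _ _ _ H1 (ER n t)) as E. now destruct (R n t).
    + intros m Hm. destruct (H2 m Hm) as [k Hk].
      pose proof (eval_functional _ _ _ _ Hk (ER n m)) as E. now destruct (R n m).
    + exact (eval_functional _ _ _ _ He (Hg t)).
Qed.

(** * The construction *)

(* A stack item [<i, s, t>] records that at stage [t] the number [s] was put into
   a set on behalf of requirement [i = <b, c>], which asks that the partial
   function coded by [c] is not a generic description of the [b]-th set. *)
Definition idx (x : nat) : nat := p1 x.
Definition wit (x : nat) : nat := p1 (p2 x).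
Definition stg (x : nat) : nat := p2 (p2 x).
Definition side (x : nat) : nat := p1 (idx x).

(** Stacks carry the largest index, that is the lowest priority, on top. Stopping at the first index
    below [i] therefore removes all items of index at least [i], and [pop (S i) l = pop i l]
    expresses that [i] has no item. *)
Fixpoint pop (i : nat) (l : list nat) : list nat :=
  match l with
  | [] => []
  | x :: l' => if idx x <? i then l else pop i l'
  end.

(* At stage [t = <i, s, w, _>] requirement [i] acts if it has no item on the stack
   and [w] witnesses that its function takes the value 0 at the large number [s]. *)
Definition acts (t : nat) (l : list nat) : bool :=
  let i := p1 t in let s := p1 (p2 t) in let w := p1 (p2 (p2 t)) in
  (code (pop (S i) l) =? code (pop i l)) && computation (p2 i) (code [s]) 0 w
  && (stg (hd 0 (pop i l)) <? s) && (i * i <=? s).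

Definition step (t : nat) (l : list nat) : list nat :=
  if acts t l then pr (p1 t) (pr (p1 (p2 t)) t) :: pop (p1 t) l else l.

Fixpoint stack (t : nat) : list nat :=
  match t with 0 => [] | S t => step t (stack t) end.

Lemma pop_pop k i l : k <= i -> pop k (pop i l) = pop k l.
Proof.
  intros H. induction l as [|x l IH]; simpl; [reflexivity|].
  destruct (Nat.ltb_spec (idx x) i) as [L|L]; simpl; [reflexivity|].
  rewrite IH. destruct (Nat.ltb_spec (idx x) k); [lia|reflexivity].
Qed.

Lemma pop_incl i l x : In x (pop i l) -> In x l.
Proof.
  induction l as [|y l IH]; simpl; [auto|].
  destruct (idx y <? i); simpl; intuition.
Qed.

Lemma pop_neq i l : pop (S i) l <> pop i l -> exists x, In x (pop (S i) l) /\ idx x = i.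
Proof.
  induction l as [|x l IH]; simpl; [congruence|].
  destruct (Nat.ltb_spec (idx x) (S i)), (Nat.ltb_spec (idx x) i);
    simpl; intros H'; try lia; try congruence; auto.
  exists x. split; [auto|lia].
Qed.

Definition above (x y : nat) : Prop := idx y < idx x /\ stg y < stg x.

Lemma pop_sorted i l : StronglySorted above l ->
  StronglySorted above (pop i l) /\ Forall (fun y => idx y < i) (pop i l).
Proof.
  induction 1 as [|x l Hl IH Hx]; simpl; [repeat constructor|].
  destruct (Nat.ltb_spec (idx x) i) as [L|L]; [|exact IH].
  split; [now constructor|]. constructor; [exact L|].
  eapply Forall_impl; [|exact Hx]. intros y [Hy _]. lia.
Qed.

Lemma stack_stg t : Forall (fun x => stg x < t) (stack t).
Proof.
  induction t as [|t IH]; [constructor|]. rewrite Forall_forall in *. simpl.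
  unfold step. destruct (acts t (stack t)); intros x Hx.
  - destruct Hx as [<-|Hx]; [unfold stg; rewrite !p2_pr; lia|].
    apply pop_incl, IH in Hx. lia.
  - apply IH in Hx. lia.
Qed.

(** An acting requirement first pops all indices not below its own, and its item is stamped with the
    current stage, which exceeds all earlier stamps. *)
Lemma stack_sorted t : StronglySorted above (stack t).
Proof.
  induction t as [|t IH]; simpl; [constructor|].
  unfold step. destruct (acts t (stack t)); [|exact IH].
  destruct (pop_sorted (p1 t) _ IH) as [H1 H2]. constructor; [exact H1|].
  rewrite Forall_forall in *. intros y Hy. split.
  - unfold idx at 2. rewrite p1_pr. auto.
  - unfold stg at 2. rewrite !p2_pr. apply pop_incl in Hy.
    pose proof (stack_stg t) as H. rewrite Forall_forall in H. auto.
Qed.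

Lemma acts_spec t l : acts t l = true ->
  pop (S (p1 t)) l = pop (p1 t) l /\
  computation (p2 (p1 t)) (code [p1 (p2 t)]) 0 (p1 (p2 (p2 t))) = true /\
  stg (hd 0 (pop (p1 t) l)) < p1 (p2 t) /\ p1 t * p1 t <= p1 (p2 t).
Proof.
  unfold acts. intros H. cbv zeta in H. split_bools.
  apply Nat.ltb_lt in H1. apply Nat.leb_le in H0. apply code_inj in H. auto.
Qed.

Lemma stack_origin t x : In x (stack t) ->
  (exists w, computation (p2 (idx x)) (code [wit x]) 0 w = true) /\ idx x * idx x <= wit x.
Proof.
  induction t as [|t IH]; simpl; [easy|]. unfold step.
  destruct (acts t (stack t)) eqn:E; [|exact IH].
  intros [<-|Hx]; [|apply IH; now apply pop_incl in Hx].
  apply acts_spec in E as (_ & H1 & _ & H2).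
  unfold idx, wit. rewrite p2_pr, !p1_pr. eauto.
Qed.

(** Items created from stage [s] on have stamps at least [s], and apart from creation items are only
    removed. *)
Lemma stack_old s t x : s <= t -> In x (stack t) -> stg x < s -> In x (stack s).
Proof.
  induction 1 as [|t Hst IH]; [auto|]. simpl. unfold step.
  destruct (acts t (stack t)); [|exact IH].
  intros [<-|Hx] Hs.
  - unfold stg in Hs. rewrite !p2_pr in Hs. lia.
  - apply IH; [now apply pop_incl in Hx|exact Hs].
Qed.

Definition clean (b : nat) (u : nat -> Prop) (l : list nat) : Prop :=
  forall x, In x l -> side x = b -> ~ u (wit x).

(* An action keeps only items of higher priority. If all of them are older than
   [s], they avoid both [u] and [v] and the new item spoils at most one of the
   two; otherwise the new witness exceeds [s] and hence avoids both. *)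
Lemma clean_preserved (u v : nat -> Prop) s t :
  (forall m, u m -> m < s) -> (forall m, v m -> m < s) ->
  clean 0 u (stack s) -> clean 1 v (stack s) -> s <= t ->
  clean 0 u (stack t) \/ clean 1 v (stack t).
Proof.
  intros Hu Hv Cu Cv. induction 1 as [|t Hst IH]; [auto|].
  simpl. unfold step. destruct (acts t (stack t)) eqn:E; [|exact IH].
  apply acts_spec in E as (_ & _ & Hs & _).
  set (x := pr _ _) in *. assert (Ew : wit x = p1 (p2 t)) by (unfold wit, x; now rewrite
    p2_pr, p1_pr).
  destruct (pop_sorted (p1 t) _ (stack_sorted t)) as [So _].
  assert (In_old : forall y, In y (pop (p1 t) (stack t)) -> stg y < s -> In y (stack s)).
  { intros y Hy. apply stack_old with t; [exact Hst|now apply pop_incl in Hy]. }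
  destruct (pop (p1 t) (stack t)) as [|y l] eqn:El;
    [|destruct (le_lt_dec s (stg y)) as [Ly|Ly]].
  - destruct (Nat.eq_dec (side x) 0) as [Sx|Sx]; [right|left];
      intros z [<-|[]] Hz; congruence.
  - simpl in Hs. destruct IH as [C|C]; [left|right]; intros z [<-|Hz] Sz Uz.
    + apply Hu in Uz. lia.
    + apply (C z); auto. apply pop_incl with (p1 t). now rewrite El.
    + apply Hv in Uz. lia.
    + apply (C z); auto. apply pop_incl with (p1 t). now rewrite El.
  - assert (Hl : forall z, In z (y :: l) -> In z (stack s)).
    { intros z Hz. apply In_old; [exact Hz|].
      inversion So as [|? ? _ Hy]; subst. rewrite Forall_forall in Hy.
      destruct Hz as [<-|Hz]; [exact Ly|]. destruct (Hy z Hz). lia. }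
    destruct (Nat.eq_dec (side x) 0) as [Sx|Sx]; [right|left];
      intros z [<-|Hz] Sz; try congruence; auto.
Qed.

Lemma pop_step k t l : k <= p1 t -> pop k (step t l) = pop k l.
Proof.
  intros H. unfold step. destruct (acts t l); [|reflexivity]. simpl.
  unfold idx. rewrite p1_pr. destruct (Nat.ltb_spec (p1 t) k); [lia|].
  now apply pop_pop.
Qed.

Lemma pop_step_acts k t l : acts t l = true -> p1 t < k ->
  pop k (step t l) = pr (p1 t) (pr (p1 (p2 t)) t) :: pop (p1 t) l.
Proof.
  intros E H. unfold step. rewrite E. simpl.
  unfold idx. rewrite p1_pr. destruct (Nat.ltb_spec (p1 t) k); [reflexivity|lia].
Qed.

(** The items of index below [i] change only through actions of requirements below [i]. *)
Lemma pop_stack_constant i t0 t :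
  (forall t, t0 <= t -> acts t (stack t) = true -> i <= p1 t) -> t0 <= t ->
  pop i (stack t) = pop i (stack t0).
Proof.
  intros H. induction 1 as [|t Ht IH]; [reflexivity|].
  rewrite <- IH. simpl. destruct (acts t (stack t)) eqn:E.
  - apply pop_step. auto.
  - unfold step. now rewrite E.
Qed.

(** The finite injury argument: once the requirements below [i] have stopped, an item of [i] can no
    longer be popped, and its presence forbids [i] to act again. So [i] acts at most once more. *)
Lemma eventually_no_action i :
  exists t0, forall t, t0 <= t -> acts t (stack t) = true -> i <= p1 t.
Proof.
  induction i as [|i [t0 IH]]; [exists 0; lia|].
  destruct (excluded_middle_informative
    (exists t1, t0 <= t1 /\ acts t1 (stack t1) = true /\ p1 t1 = i)) as [(t1 & H1 & E1 &
      Hi)|N].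
  - exists (S t1). intros t Ht Et. assert (L : i <= p1 t) by (apply IH; [lia|exact Et]).
    enough (p1 t <> i) by lia. intros Hit.
    (* The item created at [t1] stays. A further action of [i] would need [pop (S i)] and [pop i] to
       coincide, which the lengths exclude. *)
    assert (K : forall t, S t1 <= t ->
      pop (S i) (stack t) = pr (p1 t1) (pr (p1 (p2 t1)) t1) :: pop i (stack t)).
    { clear t Ht Et L Hit. induction 1 as [|t Ht IHt].
      - simpl. rewrite (pop_step i), pop_step_acts by (auto || lia). now rewrite Hi.
      - destruct (acts t (stack t)) eqn:Et.
        + pose proof (acts_spec _ _ Et) as (Ep & _).
          assert (L : i <= p1 t) by (apply IH; [lia|exact Et]).
          destruct (Nat.eq_dec (p1 t) i) as [Eti|].
          * rewrite Eti, IHt in Ep. exfalso. apply (f_equal (@length nat)) in Ep.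
            simpl in Ep. lia.
          * simpl. rewrite !pop_step by lia. exact IHt.
        + simpl. unfold step. now rewrite Et. }
    apply acts_spec in Et as (Ep & _). rewrite Hit, (K t Ht) in Ep.
    apply (f_equal (@length nat)) in Ep. simpl in Ep. lia.
  - exists t0. intros t Ht Et. pose proof (IH t Ht Et).
    enough (p1 t <> i) by lia. intros Hi. apply N. eauto.
Qed.

(** * The limit sets and their properties *)

Definition permanent (x : nat) : Prop := exists t0, forall t, t0 <= t -> In x (stack t).

(** This is [X_b], defined for every [b]. A number may be withdrawn and put in again, so membership
    settles only in the limit. *)
Definition limit_set (b s : nat) : Prop := exists x, permanent x /\ side x = b /\ wit x = s.

(** If both alternatives failed, a permanent item hitting [u] and one hitting [v] would lie together
    on all late stacks, against [clean_preserved]. *)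
Lemma limit_dichotomy (u v : nat -> Prop) s :
  (forall m, u m -> m < s) -> (forall m, v m -> m < s) ->
  clean 0 u (stack s) -> clean 1 v (stack s) ->
  (forall m, u m -> ~ limit_set 0 m) \/ (forall m, v m -> ~ limit_set 1 m).
Proof.
  intros Hu Hv Cu Cv.
  destruct (excluded_middle_informative (exists m, u m /\ limit_set 0 m)) as
    [(m & Hm & x & [tx Hx] & Sx & Wx)|N]; [|left; intros m H1 H2; apply N; eauto].
  right. intros m' Hm' (y & [ty Hy] & Sy & Wy).
  destruct (clean_preserved u v s (s + tx + ty) Hu Hv Cu Cv) as [C|C]; [lia| |].
  - apply (C x); [apply Hx; lia|exact Sx|congruence].
  - apply (C y); [apply Hy; lia|exact Sy|congruence].
Qed.

(** Needed for completeness of the search: a truly applicable axiom must look applicable at all late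
    stages. The bound [M] matters because the stack settles only below a given index at a time. *)
Lemma limit_clean b (u : nat -> Prop) :
  (forall m, u m -> ~ limit_set b m) -> (forall M, (forall m, u m -> m < M) ->
  exists t0, forall t, t0 <= t -> clean b u (stack t)).
Proof.
  intros Hu M HM.
  (* An item with a witness below [M] has small index, hence is eventually permanent. *)
  destruct (eventually_no_action (S M)) as [t0 H0].
  exists t0. intros t Ht x Hx Sx Ux. apply (Hu _ Ux). exists x. split; [|auto].
  exists t0. intros t' Ht'. apply pop_incl with (S M).
  rewrite (pop_stack_constant (S M) t0 t' H0 Ht'), <- (pop_stack_constant (S M) t0 t H0 Ht).
  destruct (stack_origin _ _ Hx) as [_ Hi]. apply HM in Ux.
  assert (L : idx x < S M) by nia.
  clear -Hx L. induction (stack t) as [|y l IH]; [easy|]. simpl.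
  destruct (Nat.ltb_spec (idx y) (S M)); [exact Hx|].
  destruct Hx as [<-|Hx]; [lia|auto].
Qed.

(** After the last action of the requirements up to [i], either [i] owns an item, which is permanent
    and carries a computation with value 0, or no suitable witness beyond [r] exists, since it would
    make [i] act. *)
Lemma limit_set_diagonal b c :
  exists r, forall s, r < s -> eval c [s] 0 -> exists s', limit_set b s' /\ eval c [s'] 0.
Proof.
  set (i := pr b (recfun_code c)).
  destruct (eventually_no_action (S i)) as [t0 H0].
  destruct (excluded_middle_informative
    (pop (S i) (stack t0) = pop i (stack t0))) as [E|E].
  (* The two summands enforce the two size conditions in [acts]. *)
  - exists (stg (hd 0 (pop i (stack t0))) + i * i). intros s Hs Hc. exfalso.
    apply computation_spec in Hc as [w Hw].
    (* Placing [t0] in the free component makes this stage at least [t0]. *)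
    set (t := pr i (pr s (pr w t0))).
    assert (Ht : t0 <= t).
    { unfold t. pose proof (pr_le_r i (pr s (pr w t0))).
      pose proof (pr_le_r s (pr w t0)). pose proof (pr_le_r w t0). lia. }
    assert (Hi : p1 t = i) by apply p1_pr.
    assert (Ei : pop i (stack t) = pop i (stack t0)).
    { rewrite <- (pop_pop i (S i) (stack t)), <- (pop_pop i (S i) (stack t0)) by lia.
      f_equal. now apply pop_stack_constant. }
    enough (A : acts t (stack t) = true) by (apply H0 in A; lia).
    unfold acts. cbv zeta. rewrite Hi.
    assert (Es : p1 (p2 t) = s) by (unfold t; now rewrite p2_pr, p1_pr).
    assert (Ew : p1 (p2 (p2 t)) = w) by (unfold t; now rewrite !p2_pr, p1_pr).
    assert (Ec : p2 i = recfun_code c) by apply p2_pr.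
    rewrite Es, Ew, Ec.
    rewrite Ei, (pop_stack_constant (S i) t0 t H0 Ht), E, Nat.eqb_refl.
    apply Bool.andb_true_iff. split; [apply Bool.andb_true_iff; split|].
    + exact Hw.
    + apply Nat.ltb_lt. lia.
    + apply Nat.leb_le. lia.
  - exists 0. intros _ _ _. apply pop_neq in E as (x & Hx & Ex).
    exists (wit x). split.
    + exists x. split; [|split; [unfold side; rewrite Ex; apply p1_pr|reflexivity]].
      exists t0. intros t Ht. apply pop_incl with (S i).
      now rewrite (pop_stack_constant (S i) t0 t H0 Ht).
    + apply pop_incl in Hx. destruct (stack_origin _ _ Hx) as [[w Hw] _].
      rewrite Ex in Hw. unfold i in Hw. rewrite p2_pr in Hw.
      apply computation_spec. eauto.
Qed.

(** Here [g] sends an element to the index of a requirement holding it permanently. Indices on a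
    stack are distinct, so two permanent items with equal index, compared at a common late stage,
    coincide. *)
Lemma limit_set_sparse b : exists g : nat -> nat,
  (forall s, limit_set b s -> g s * g s <= s) /\
  (forall s s', limit_set b s -> limit_set b s' -> g s = g s' -> s = s').
Proof.
  exists (fun s => match excluded_middle_informative (limit_set b s) with
                   | left H => idx (proj1_sig (constructive_indefinite_description _ H))
                   | right _ => 0 end).
  split.
  - intros s Hs. destruct (excluded_middle_informative (limit_set b s)) as [H|]; [|easy].
    destruct (constructive_indefinite_description _ H) as (x & [t Ht] & Sx & <-). simpl.
    apply (stack_origin t x). auto.
  - intros s s' Hs Hs'.
    destruct (excluded_middle_informative (limit_set b s)) as [H|]; [|easy].
    destruct (excluded_middle_informative (limit_set b s')) as [H'|]; [|easy].
    destruct (constructive_indefinite_description _ H) as (x & [t Ht] & Sx & <-).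
    destruct (constructive_indefinite_description _ H') as (x' & [t' Ht'] & Sx' & <-). simpl.
    intros E. f_equal.
    specialize (Ht (t + t') ltac:(lia)). specialize (Ht' (t + t') ltac:(lia)).
    pose proof (stack_sorted (t + t')) as So. clear -E Ht Ht' So.
    induction So as [|y l So IH Hy]; [easy|]. rewrite Forall_forall in Hy.
    destruct Ht as [<-|Ht], Ht' as [<-|Ht']; auto.
    + destruct (Hy _ Ht'). lia.
    + destruct (Hy _ Ht). lia.
Qed.

(** * Computability of the construction *)

(** Since the length of a list is at most its code, [z] rounds suffice; a finished state, including
    the empty list, is a fixed point of the loop body. *)
Definition pop_code (i z : nat) : nat :=
  nat_rect (fun _ => nat) z (fun _ r => if idx (head r) <? i then r else tail r) z.

Lemma pop_code_spec i l : pop_code i (code l) = code (pop i l).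
Proof.
  unfold pop_code. set (f := fun r => if idx (head r) <? i then r else tail r).
  assert (Hf : forall n z, nat_rect (fun _ => nat) z (fun _ => f) (S n) =
                           nat_rect (fun _ => nat) (f z) (fun _ => f) n).
  { induction n as [|n IH]; intros z; [reflexivity|].
    change (f (nat_rect (fun _ => nat) z (fun _ => f) (S n)) =
            f (nat_rect (fun _ => nat) (f z) (fun _ => f) n)). now rewrite IH. }
  assert (Hx : forall n z, f z = z -> nat_rect (fun _ => nat) z (fun _ => f) n = z).
  { intros n z E. induction n as [|n IH]; simpl; congruence. }
  (* The induction needs a round count [n] detached from the list, with only [length l <= n]
     retained. *)
  pose proof (length_code l) as L. revert L. generalize (code l) at 1 3 as n.
  intros n. revert n. induction l as [|x l IH]; intros n L.
  - apply Hx. unfold f. now destruct (idx _ <? i).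
  - simpl in L. destruct n as [|n]; [lia|]. rewrite Hf. simpl pop.
    assert (E : f (code (x :: l)) = if idx x <? i then code (x :: l) else code l).
    { unfold f. simpl. now rewrite head_cons, tail_cons. }
    destruct (idx x <? i) eqn:Ex; rewrite E.
    + now apply Hx.
    + apply IH. lia.
Qed.

Lemma computable_idx f : computable f -> computable (fun e => idx (f e)).
Proof. intros. unfold idx. auto with computable. Qed.
Lemma computable_wit f : computable f -> computable (fun e => wit (f e)).
Proof. intros. unfold wit. auto with computable. Qed.
Lemma computable_stg f : computable f -> computable (fun e => stg (f e)).
Proof. intros. unfold stg. auto with computable. Qed.
Lemma computable_side f : computable f -> computable (fun e => side (f e)).
Proof. intros. unfold side, idx. auto with computable. Qed.

#[local] Hint Resolve computable_idx computable_wit computable_stg computable_side :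
  computable.

Lemma computable_pop_code f g :
  computable f -> computable g -> computable (fun e => pop_code (f e) (g e)).
Proof.
  intros. unfold pop_code.
  apply (computable_rec _ _ (fun _ r e => if idx (head r) <? f e then r else tail r)); auto.
  apply computable_if; auto with computable.
  apply decidable_ltb; auto with computable.
  apply (computable_app f); auto with computable.
Qed.

#[local] Hint Resolve computable_pop_code : computable.

Definition step_code (t z : nat) : nat :=
  let i := p1 t in let s := p1 (p2 t) in
  if ((pop_code (S i) z =? pop_code i z)
      && computation (p2 i) (cons_code s 0) 0 (p1 (p2 (p2 t)))
      && (stg (head (pop_code i z)) <? s) && (i * i <=? s))%bool
  then cons_code (pr i (pr s t)) (pop_code i z) else z.

Lemma step_code_spec t l : step_code t (code l) = code (step t l).
Proof.
  unfold step_code, step, acts. cbv zeta. rewrite !pop_code_spec.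
  replace (head (code (pop (p1 t) l))) with (hd 0 (pop (p1 t) l)).
  - simpl code. now destruct (_ && _)%bool.
  - destruct (pop (p1 t) l); simpl; [reflexivity|now rewrite head_cons].
Qed.

Lemma computable_stack f : computable f -> computable (fun e => code (stack (f e))).
Proof.
  apply (computable_app (fun t => code (stack t))).
  apply (computable_ext (fun t => nat_rect (fun _ => nat) 0 (fun n r => step_code n r) t)).
  - intros t. induction t as [|t IH]; [reflexivity|]. simpl in *.
    now rewrite IH, step_code_spec.
  - apply (computable_rec (fun _ => 0) (fun t => t) (fun n r _ => step_code n r));
      auto with computable.
    unfold step_code. cbv zeta. apply computable_if; auto 10 with computable.
Qed.

(** * Density *)

Lemma char_bool_true A n : char_bool A n = true <-> A n.
Proof. unfold char_bool. destruct (excluded_middle_informative (A n)); split; auto;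
  discriminate. Qed.

Lemma char_bool_spec A n : Bool.reflect (A n) (char_bool A n).
Proof. apply Bool.iff_reflect. symmetry. apply char_bool_true. Qed.

Lemma count_below_not A n : count_below A n + count_below (fun m => ~ A m) n = n.
Proof.
  unfold count_below. rewrite <- (length_seq n 0) at 3.
  induction (seq 0 n) as [|m l IH]; simpl; [reflexivity|].
  destruct (char_bool_spec A m), (char_bool_spec (fun m => ~ A m) m);
    simpl; try tauto; lia.
Qed.

Lemma count_below_or (A B C : nat -> Prop) n :
  (forall m, A m -> B m \/ C m) -> count_below A n <= count_below B n + count_below C n.
Proof.
  intros H. unfold count_below. induction (seq 0 n) as [|m l IH]; simpl; [lia|].
  specialize (H m).
  destruct (char_bool_spec A m), (char_bool_spec B m), (char_bool_spec C m);
    simpl; try tauto; lia.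
Qed.

Lemma count_below_image (A : nat -> Prop) (g : nat -> nat) n b :
  (forall s, A s -> s < n -> g s < b) ->
  (forall s s', A s -> A s' -> g s = g s' -> s = s') -> count_below A n <= b.
Proof.
  intros Hb Hg. unfold count_below.
  assert (HA : forall s, In s (filter (char_bool A) (seq 0 n)) <-> s < n /\ A s).
  { intros s. rewrite filter_In, in_seq, char_bool_true. intuition lia. }
  rewrite <- (length_map g), <- (length_seq b 0). apply NoDup_incl_length.
  - apply NoDup_map_NoDup_ForallPairs; [|apply NoDup_filter, seq_NoDup].
    intros s s' Hs Hs'. apply HA in Hs as [_ Hs], Hs' as [_ Hs']. auto.
  - intros i Hi. apply in_map_iff in Hi as (s & <- & Hs). apply HA in Hs as [Hn Hs].
    apply in_seq. split; [lia|]. now apply Hb.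
Qed.

(** The distance of the quotient from 1 is the proportion of the complement. Later density arguments
    use this integer form and avoid real numbers. *)
Lemma density_one_iff A : density_one A <->
  forall k, exists N, forall n, N <= n -> k * count_below (fun m => ~ A m) n <= n.
Proof.
  assert (E : forall n, 0 < n ->
    Rdist (INR (count_below A n) / INR n) 1 = (INR (count_below (fun m => ~ A m) n) / INR
      n)%R).
  { intros n Hn. apply lt_INR in Hn. simpl in Hn.
    pose proof (count_below_not A n) as H. apply (f_equal INR) in H. rewrite plus_INR in H.
    pose proof (pos_INR (count_below (fun m => ~ A m) n)) as P.
    replace (INR (count_below A n)) with (INR n - INR (count_below (fun m => ~ A m) n))%R by
      lra.
    unfold Rdist. rewrite <- Rabs_Ropp, Rabs_pos_eq; [field; lra|].
    replace (- _)%R with (INR (count_below (fun m => ~ A m) n) * / INR n)%R by (field; lra).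
    apply Rmult_le_pos; [exact P|]. left. now apply Rinv_0_lt_compat. }
  split.
  (* Taking [1/(k+1)] instead of [1/k] covers [k = 0]; the later threshold [S N] keeps [n]
     positive. *)
  - intros H k. destruct (H (/ INR (S k))%R) as [N HN].
    { apply Rinv_0_lt_compat, lt_0_INR. lia. }
    exists (S N). intros n Hn. specialize (HN n ltac:(lia)). rewrite E in HN by lia.
    apply INR_le. rewrite mult_INR.
    assert (Hn' : (0 < INR n)%R) by (apply lt_0_INR; lia).
    assert (Hk : (0 < INR (S k))%R) by (apply lt_0_INR; lia).
    pose proof (pos_INR (count_below (fun m => ~ A m) n)) as P.
    apply Rmult_lt_compat_r with (r := (INR n * INR (S k))%R) in HN; [|nra].
    replace (/ INR (S k) * (INR n * INR (S k)))%R with (INR n) in HN by (field; lra).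
    match type of HN with (?l < _)%R =>
      replace l with (INR (S k) * INR (count_below (fun m => ~ A m) n))%R in HN by (field;
        lra) end.
    rewrite S_INR in HN. lra.
  - intros H eps Heps. destruct (archimed_cor1 eps Heps) as (k & Hk & Hk0).
    destruct (H k) as [N HN]. exists (S N). intros n Hn. rewrite E by lia.
    specialize (HN n ltac:(lia)). apply le_INR in HN. rewrite mult_INR in HN.
    assert (Hn' : (0 < INR n)%R) by (apply lt_0_INR; lia).
    assert (Hk' : (0 < INR k)%R) by (apply lt_0_INR; lia).
    apply Rle_lt_trans with (/ INR k)%R; [|exact Hk].
    apply Rmult_le_reg_r with (INR n * INR k)%R; [nra|].
    replace (/ INR k * (INR n * INR k))%R with (INR n) by (field; lra).
    match goal with |- (?l <= _)%R =>
      replace l with (INR k * INR (count_below (fun m => ~ A m) n))%R by (field; lra) end.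
    exact HN.
Qed.

Lemma density_one_and (A B C : nat -> Prop) :
  density_one A -> density_one B -> (forall m, A m -> B m -> C m) -> density_one C.
Proof.
  rewrite !density_one_iff. intros HA HB H k.
  (* Each of the two complements is granted half of the allowed proportion. *)
  destruct (HA (2 * k)) as [M HM], (HB (2 * k)) as [N HN].
  exists (M + N). intros n Hn. specialize (HM n ltac:(lia)). specialize (HN n ltac:(lia)).
  assert (L : count_below (fun m => ~ C m) n <=
    count_below (fun m => ~ A m) n + count_below (fun m => ~ B m) n).
  { apply count_below_or. intros m Hm.
    destruct (excluded_middle_informative (A m)); [right|left]; auto. }
  apply (Nat.mul_le_mono_l _ _ k) in L. lia.
Qed.

Lemma density_one_unbounded A r : density_one A -> exists s, r < s /\ A s.
Proof.
  rewrite density_one_iff. intros H. destruct (H 2) as [N HN].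
  destruct (excluded_middle_informative (exists s, r < s /\ A s)) as [|F];
    [assumption|exfalso].
  (* This length is beyond [N] and larger than [2 * (r + 1)], so at most [r + 1] elements of [A]
     make up less than half of it. *)
  specialize (HN (N + 2 * r + 3) ltac:(lia)).
  pose proof (count_below_not A (N + 2 * r + 3)) as E.
  assert (L : count_below A (N + 2 * r + 3) <= S r).
  { apply count_below_image with (fun s => s); [|auto].
    intros s Hs _. destruct (le_lt_dec s r); [lia|]. exfalso. eauto. }
  lia.
Qed.

Lemma density_one_sparse (X : nat -> Prop) (g : nat -> nat) :
  (forall s, X s -> g s * g s <= s) ->
  (forall s s', X s -> X s' -> g s = g s' -> s = s') -> density_one (fun s => ~ X s).
Proof.
  (* From [(k+1)^2] on, [q = Nat.sqrt n] is at least [k + 1], so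
     [k * (q + 1) <= (q - 1) * (q + 1) < n]. *)
  intros Hg Hi. apply density_one_iff. intros k. exists (S k * S k). intros n Hn.
  pose proof (Nat.sqrt_spec' n) as [Q1 Q2].
  assert (L : count_below (fun s => ~ ~ X s) n <= S (Nat.sqrt n)).
  { apply count_below_image with g.
    - intros s Hs Hsn. apply NNPP, Hg in Hs. nia.
    - intros s s' Hs Hs'. apply Hi; now apply NNPP. }
  assert (S k <= Nat.sqrt n) by nia. nia.
Qed.

(** * The minimal pair *)

Definition description (b n : nat) : option nat :=
  if excluded_middle_informative (limit_set b n) then None else Some 0.

Lemma description_Some b n v : description b n = Some v <-> ~ limit_set b n /\ v = 0.
Proof.
  unfold description. destruct (excluded_middle_informative (limit_set b n));
    intuition congruence.
Qed.

Lemma density_one_limit_set b : density_one (fun s => ~ limit_set b s).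
Proof. destruct (limit_set_sparse b) as (g & H1 & H2). now apply density_one_sparse with g.
  Qed.

Lemma generic_description_description b : generic_description (limit_set b) (description b).
Proof.
  split.
  - apply (density_one_and _ _ _ (density_one_limit_set b) (density_one_limit_set b)).
    intros m H _. exists 0. now apply description_Some.
  - intros n v H. apply description_Some in H as [H ->].
    now destruct (char_bool_spec (limit_set b) n).
Qed.

(** The domain of a description and the complement of the sparse set both have density 1, so the
    description takes the value 0 at arbitrarily large numbers and its requirement cannot wait
    forever. *)
Lemma limit_set_not_generically_computable b : ~ generically_computable (limit_set b).
Proof.
  intros (f & [c Hc] & Hd & Hf). destruct (limit_set_diagonal b c) as [r Hr].
  destruct (density_one_unbounded (fun s => dom f s /\ ~ limit_set b s) r) as (s & Hs & [v
    Hv] & Xs).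
  - apply (density_one_and _ _ _ Hd (density_one_limit_set b)). auto.
  - pose proof (Hf _ _ Hv) as E.
    destruct (char_bool_spec (limit_set b) s) as [|_]; [easy|].
    simpl in E. subst v. apply Hc in Hv. destruct (Hr s Hs Hv) as (s' & Xs' & E').
    apply Hc, Hf in E'. apply char_bool_true in Xs'. rewrite Xs' in E'. discriminate.
Qed.

(** * Computability of binary digits *)

Lemma decidable_odd f : computable f -> decidable (fun e => Nat.odd (f e)).
Proof.
  apply (computable_app (fun a => Nat.b2n (Nat.odd a))).
  apply (computable_ext (fun a => nat_rect (fun _ => nat) 0 (fun _ r => 1 - r) a)).
  - intros a. induction a as [|a IH]; [reflexivity|].
    rewrite Nat.odd_succ, <- Nat.negb_odd. simpl in *. rewrite IH. now destruct (Nat.odd a).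
  - apply (computable_rec (fun _ => 0) (fun a => a) (fun _ r _ => 1 - r)); auto with
    computable.
Qed.

(** [Nat.div2 a] counts the odd numbers below [a]. *)
Lemma computable_div2 f : computable f -> computable (fun e => Nat.div2 (f e)).
Proof.
  apply (computable_app Nat.div2).
  apply (computable_ext (fun a => nat_rect (fun _ => nat) 0 (fun n r => r + Nat.b2n (Nat.odd
    n)) a)).
  - intros a. induction a as [|a IH]; [reflexivity|]. simpl in *. rewrite IH.
    pose proof (Nat.div2_odd a). pose proof (Nat.div2_odd (S a)) as H'.
    rewrite Nat.odd_succ, <- Nat.negb_odd in H'.
    change (match a with 0 => 0 | S n => S (Nat.div2 n) end) with (Nat.div2 (S a)).
    destruct (Nat.odd a); simpl Nat.b2n in *; lia.
  - apply (computable_rec (fun _ => 0) (fun a => a) (fun n r _ => r + Nat.b2n (Nat.odd n)));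
      auto with computable.
    apply computable_add; auto with computable. apply decidable_odd; auto with computable.
Qed.

Lemma decidable_testbit f g :
  computable f -> computable g -> decidable (fun e => Nat.testbit (f e) (g e)).
Proof.
  intros.
  apply (computable_ext (fun e => Nat.b2n (Nat.odd
    (nat_rect (fun _ => nat) (f e) (fun _ r => Nat.div2 r) (g e))))).
  - intros e. f_equal. generalize (f e) as a. induction (g e) as [|n IH]; intros a;
    [reflexivity|].
    simpl Nat.testbit. rewrite <- IH. f_equal. clear IH.
    induction n as [|n IH]; simpl in *; congruence.
  - apply decidable_odd, (computable_rec _ _ (fun _ r _ => Nat.div2 r)); auto with computable.
    apply computable_div2; auto with computable.
Qed.

#[local] Hint Resolve computable_stack decidable_testbit decidable_member : computable.

(** If bit [i] of [u] is set, then [i < 2 ^ i <= u]; thus [u] bounds the search through its own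
    elements. *)
Lemma finite_set_lt u i : finite_set u i -> i < u.
Proof.
  intros H. unfold finite_set in H.
  apply Nat.lt_le_trans with (2 ^ i); [apply Nat.pow_gt_lin_r; lia|].
  destruct (le_lt_dec (2 ^ i) u) as [L|L]; [exact L|].
  rewrite Nat.testbit_eqb, Nat.div_small in H by exact L. discriminate.
Qed.

(* The set coded by [u] looks like a part of the graph of [description b] at stage [s]. *)
Definition admissible (b s u : nat) : bool :=
  forallb (fun i => negb (Nat.testbit u i) ||
    (p2 i =? 0) && (p1 i <? s) &&
    negb (member (fun x => (side x =? b) && (wit x =? p1 i)) (code (stack s))))%bool (seq 0 u).

Lemma decidable_admissible b f g :
  computable f -> computable g -> decidable (fun e => admissible b (f e) (g e)).
Proof.
  intros Hf Hg.
  apply (computable_ext (fun e => Nat.b2n (admissible b (p1 (pr (f e) (g e))) (p2 (pr (f e)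
    (g e)))))).
  { intros e. now rewrite p1_pr, p2_pr. }
  apply (computable_app (fun z => Nat.b2n (admissible b (p1 z) (p2 z)))); [|auto with
    computable].
  unfold admissible.
  apply (decidable_forallb (fun i z => negb (Nat.testbit (p2 z) i) ||
    (p2 i =? 0) && (p1 i <? p1 z) &&
    negb (member (fun x => (side x =? b) && (wit x =? p1 i)) (code (stack (p1 z)))))%bool);
    [auto with computable|].
  apply decidable_orb; [auto 10 with computable|].
  apply decidable_andb; [auto 10 with computable|]. apply decidable_negb.
  apply (decidable_member (fun x z => (side x =? b) && (wit x =? p1 (p1 z)))%bool);
    auto 10 with computable.
Qed.

(** The numbers at which [u] demands the value 0, which therefore have to stay out of the set being
    described. *)
Definition avoided (u m : nat) : Prop := finite_set u (pr m 0).

Lemma admissible_spec b s u : admissible b s u = true <->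
  (forall i, finite_set u i -> p2 i = 0 /\ p1 i < s) /\ clean b (avoided u) (stack s).
Proof.
  unfold admissible, clean, avoided, finite_set. rewrite forallb_forall. split.
  - intros H.
    assert (K : forall i, Nat.testbit u i = true -> p2 i = 0 /\ p1 i < s /\
      member (fun x => (side x =? b) && (wit x =? p1 i))%bool (code (stack s)) = false).
    { intros i Hi. assert (Hu : In i (seq 0 u)).
      { apply in_seq. split; [lia|]. now apply finite_set_lt. }
      specialize (H i Hu). rewrite Hi in H. simpl in H. split_bools.
      apply Nat.ltb_lt in H1. apply Bool.negb_true_iff in H0. auto. }
    split.
    + intros i Hi. now destruct (K i Hi) as (H1 & H2 & _).
    + intros x Hx Sx Ux. apply K in Ux as (_ & _ & E). rewrite p1_pr in E.
      apply Bool.not_true_iff_false in E. apply E, member_code.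
      exists x. split; [exact Hx|]. now rewrite Sx, !Nat.eqb_refl.
  - intros [H C] i _. destruct (Nat.testbit u i) eqn:E; [|reflexivity]. simpl.
    destruct (H i E) as [H1 H2]. rewrite H1, Nat.eqb_refl, (proj2 (Nat.ltb_lt _ _) H2). simpl.
    apply Bool.negb_true_iff, Bool.not_true_iff_false. intros M.
    apply member_code in M as (x & Hx & M). split_bools.
    apply (C x Hx); [assumption|]. now rewrite H3, <- H1, pr_p.
Qed.

Lemma graph_description b u :
  (forall i, finite_set u i -> graph (description b) i) <->
  (forall i, finite_set u i -> p2 i = 0) /\ (forall m, avoided u m -> ~ limit_set b m).
Proof.
  split.
  - intros H. split.
    + intros i Hi. destruct (H i Hi) as (n & v & Hv & ->).
      apply description_Some in Hv as [_ ->]. apply (p2_pr n 0).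
    + intros m Hm. destruct (H _ Hm) as (n & v & Hv & E).
      apply (pr_inj m 0 n v) in E as [-> _]. now apply description_Some in Hv.
  - intros [H1 H2] i Hi. pose proof (H1 i Hi) as E. exists (p1 i), 0. split.
    + apply description_Some. split; [|reflexivity]. apply H2.
      unfold avoided. now rewrite <- E, pr_p.
    + change (i = pr (p1 i) 0). now rewrite <- E, pr_p.
Qed.

Lemma eventually_admissible b u : (forall i, finite_set u i -> graph (description b) i) ->
  exists s0, forall s, s0 <= s -> admissible b s u = true.
Proof.
  intros H. apply graph_description in H as [H1 H2].
  assert (HA : forall m, avoided u m -> m < u).
  { intros m Hm. apply finite_set_lt in Hm. pose proof (pr_le_l m 0). lia. }
  destruct (limit_clean b (avoided u) H2 u HA) as [t0 Ht0].
  exists (u + t0). intros s Hs. apply admissible_spec. split; [|apply Ht0; lia].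
  intros i Hi. split; [now apply H1|]. apply finite_set_lt in Hi.
  pose proof (pr_le_l (p1 i) (p2 i)) as L. rewrite pr_p in L. lia.
Qed.

Lemma admissible_dichotomy s u v :
  admissible 0 s u = true -> admissible 1 s v = true ->
  (forall i, finite_set u i -> graph (description 0) i) \/
  (forall i, finite_set v i -> graph (description 1) i).
Proof.
  intros Hu Hv. apply admissible_spec in Hu as [Hu Cu], Hv as [Hv Cv].
  destruct (limit_dichotomy (avoided u) (avoided v) s) as [L|L]; auto.
  - intros m Hm. destruct (Hu _ Hm) as [_ H]. now rewrite p1_pr in H.
  - intros m Hm. destruct (Hv _ Hm) as [_ H]. now rewrite p1_pr in H.
  - left. apply graph_description. split; [|exact L]. intros i Hi. now apply Hu.
  - right. apply graph_description. split; [|exact L]. intros i Hi. now apply Hv.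
Qed.

(** * The search for agreements *)

(** Membership in a c.e. set of pairs depends on halting alone, so the output is read off the
    certificate [w] itself. *)
Definition halting_computation (c u k w : nat) : bool :=
  computation c (cons_code u (cons_code k 0)) (jval (head w)) w.

Lemma halting_computation_spec c u k :
  (exists y, eval c [u; k] y) <-> exists w, halting_computation (recfun_code c) u k w = true.
Proof.
  unfold halting_computation. split.
  - intros [y Hy]. apply computation_spec in Hy as [w Hw]. exists w.
    simpl in Hw. replace (jval (head w)) with y; [exact Hw|].
    unfold computation in Hw. split_bools. rewrite H0. now rewrite jval_judge.
  - intros [w Hw]. eexists. apply computation_spec. simpl. eauto.
Qed.

(* [t] codes a value [a], a stage [s] and axioms [(u, <n, a>)], [(v, <n, a>)] of the
   two operators that are both applicable at stage [s]. *)
Definition agreement (c d n t : nat) : bool :=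
  let a := p1 t in let s := p1 (p2 t) in
  let u := p1 (p2 (p2 t)) in let v := p1 (p2 (p2 (p2 t))) in
  let w := p1 (p2 (p2 (p2 (p2 t)))) in let x := p2 (p2 (p2 (p2 (p2 t)))) in
  (admissible 0 s u && admissible 1 s v
   && halting_computation c u (pr n a) w && halting_computation d v (pr n a) x)%bool.

Lemma decidable_agreement c d : decidable (fun z => agreement c d (p1 z) (p2 z)).
Proof.
  unfold agreement, halting_computation. cbv zeta.
  apply decidable_andb; [apply decidable_andb; [apply decidable_andb|]|];
    first [apply decidable_admissible | apply decidable_computation]; auto 20 with computable.
Qed.

Lemma least_witness (R : nat -> bool) : (exists t, R t = true) ->
  exists t, R t = true /\ forall t', t' < t -> R t' = false.
Proof.
  intros [t Ht]. induction t as [t IH] using (well_founded_induction lt_wf).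
  destruct (excluded_middle_informative (exists t', t' < t /\ R t' = true)) as [(t' & L &
    H)|N].
  - now apply IH with t'.
  - exists t. split; [exact Ht|]. intros t' L. destruct (R t') eqn:E; [|reflexivity].
    exfalso. eauto.
Qed.

Lemma limit_sets_lower_bound Y :
  nonuniformly_generically_reducible Y (limit_set 0) ->
  nonuniformly_generically_reducible Y (limit_set 1) -> generically_computable Y.
Proof.
  intros R0 R1.
  destruct (R0 _ (generic_description_description 0)) as (h0 & [D0 V0] & W & [c Hc] & HW).
  destruct (R1 _ (generic_description_description 1)) as (h1 & [D1 V1] & V & [d Hd] & HV).
  set (R := agreement (recfun_code c) (recfun_code d)).
  assert (Sound : forall n t, R n t = true -> p1 t = Nat.b2n (char_bool Y n)).
  { intros n t H. unfold R, agreement in H. cbv zeta in H. split_bools.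
    set (k := pr n (p1 t)) in *.
    set (u := p1 (p2 (p2 t))) in *. set (v := p1 (p2 (p2 (p2 t)))) in *.
    assert (Wu : W u k) by (apply Hc, halting_computation_spec; eauto).
    assert (Vv : V v k) by (apply Hd, halting_computation_spec; eauto).
    destruct (admissible_dichotomy _ _ _ H H2) as [G|G].
    - destruct (proj2 (HW k)) as (n' & a & Ha & E); [exists u; auto|].
      apply (pr_inj n (p1 t) n' a) in E as [-> ->]. now apply V0.
    - destruct (proj2 (HV k)) as (n' & a & Ha & E); [exists v; auto|].
      apply (pr_inj n (p1 t) n' a) in E as [-> ->]. now apply V1. }
  (* On the common domain both operators produce the same value of [Y]; the axioms behind it hold in
     the limit, so they are both admissible at some common late stage. *)
  assert (Complete : forall n, dom h0 n -> dom h1 n -> exists t, R n t = true).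
  { intros n [a Ha] [a' Ha']. assert (a' = a) as -> by (rewrite (V0 _ _ Ha); now apply V1).
    destruct (proj1 (HW (pr n a))) as (u & Wu & Gu); [exists n, a; auto|].
    destruct (proj1 (HV (pr n a))) as (v & Vv & Gv); [exists n, a; auto|].
    apply Hc, halting_computation_spec in Wu as [w Hw].
    apply Hd, halting_computation_spec in Vv as [x Hx].
    apply eventually_admissible in Gu as [s Hs], Gv as [s' Hs'].
    exists (pr a (pr (s + s') (pr u (pr v (pr w x))))).
    unfold R, agreement. cbv zeta. repeat first [rewrite p1_pr | rewrite p2_pr].
    rewrite Hs, Hs', Hw, Hx by lia. reflexivity. }
  (* By [Sound] every agreement at [n] gives the same value; the least one is chosen because that is
     what [Min] finds. *)
  exists (fun n => match excluded_middle_informative (exists t, R n t = true) with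
     | left H => Some (p1 (proj1_sig (constructive_indefinite_description _ (least_witness _
       H))))
     | right _ => None end).
  split; [|split].
  - apply partial_computable_search with R p1.
    + apply decidable_agreement.
    + apply computable_p1, computable_id.
    + intros n v. destruct (excluded_middle_informative (exists t, R n t = true)) as [H|H].
      * destruct (constructive_indefinite_description _ _) as (t & Ht & Lt). simpl. split.
        -- intros [= <-]. eauto.
        -- intros (t' & Ht' & Lt' & ->). f_equal.
           destruct (lt_eq_lt_dec t t') as [[L| ->]|L]; [|reflexivity|].
           ++ apply Lt' in L. congruence.
           ++ apply Lt in L. congruence.
      * split; [discriminate|]. intros (t & Ht & _). exfalso. eauto.
  - apply (density_one_and _ _ _ D0 D1). intros n H0 H1. unfold dom.
    destruct (excluded_middle_informative (exists t, R n t = true)) as [H|H]; [eauto|].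
    exfalso. auto.
  - intros n v. destruct (excluded_middle_informative (exists t, R n t = true)) as [H|H];
      [|discriminate].
    destruct (constructive_indefinite_description _ _) as (t & Ht & Lt). simpl.
    intros [= <-]. now apply Sound.
Qed.

Lemma uniformly_nonuniformly A B :
  uniformly_generically_reducible A B -> nonuniformly_generically_reducible A B.
Proof.
  intros (W & Wce & H) f Hf. destruct (H f Hf) as (h & Hh & Hy).
  exists h. split; [exact Hh|]. now exists W.
Qed.

Theorem theorem3 :
  exists X0 X1 : nat -> Prop,
    minimal_pair nonuniformly_generically_reducible X0 X1 /\
    minimal_pair uniformly_generically_reducible X0 X1.
Proof.
  exists (limit_set 0), (limit_set 1).
  split; (split; [apply limit_set_not_generically_computable|
          split; [apply limit_set_not_generically_computable|]]).
  - apply limit_sets_lower_bound.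
  - intros Y H0 H1. apply limit_sets_lower_bound; now apply uniformly_nonuniformly.
Qed.
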